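(* Let $(\varepsilon_n)_n$ be an arbitrary sequence of positive numbers tending to $0$. Then there exist a locally compact group $G$ of polynomial growth of degree $3$, a compact generating set $\Omega$ in $G$ and $c>0$ such that $$\frac{vol_G(\Omega^n)}{c\cdot n^3}\le1-\varepsilon_n$$ holds for infinitely many $n$, although $\frac1{c\cdot n^3}vol_G(\Omega^n)\to1$ as $n\to+\infty$.
   Context: $vol_G$ is a Haar measure on $G$ and $\Omega^n$ is the $n$-fold product set. Polynomial growth of degree $3$ means that, for a compact symmetric generating set $\Omega$, $vol_G(\Omega^n)$ is bounded above and below by positive constants times $n^3$ for large $n$. *)

(* Defs.v *)
From HB Require Import structures.
From mathcomp Require Import all_boot all_order all_algebra.
From mathcomp Require Import all_classical all_reals all_analysis.

Set Implicit Arguments.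
Unset Strict Implicit.
Unset Printing Implicit Defensive.

Import Order.TTheory GRing.Theory Num.Theory.
Import numFieldNormedType.Exports.

Local Open Scope classical_set_scope.
Local Open Scope ring_scope.

(* MathComp-Analysis only has additive (commutative) topological groups, so we
   join its topological spaces with the multiplicative groups of monoid.v.
   The structure [PointedTopological] is used because [g_sigma_algebraType]
   expects a pointed type; the distinguished point plays no role. *)
HB.mixin Record isTopologicalGroup G & Group G & PointedTopological G := {
  mulg_continuous : continuous (fun x : G * G => (x.1 * x.2)%g);
  invg_continuous : continuous (fun x : G => (x^-1)%g)
}.

#[short(type="topologicalGroupType")]
HB.structure Definition TopologicalGroup :=
  {G of Group G & PointedTopological G & isTopologicalGroup G}.

(* The Hausdorff axiom is part of the usual convention. *)
Definition locally_compact_group (G : topologicalGroupType) : Prop :=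
  hausdorff_space G /\ locally_compact [set: G].

Section GroupSubsets.
Variable G : topologicalGroupType.
Implicit Types (A B H : set G) (n : nat).

Definition set_mulg A B : set G := [set (x * y)%g | x in A & y in B].

Definition set_expg A n : set G := iter n (set_mulg A) [set 1%g].

Definition symmetric_set A : Prop := forall x, A x -> A (x^-1)%g.

Definition is_subgroup H : Prop :=
  H 1%g /\ forall x y, H x -> H y -> H (x / y)%g.

Definition generating_set A : Prop := smallest is_subgroup A = [set: G].

End GroupSubsets.

Definition borel (G : topologicalGroupType) := g_sigma_algebraType (@open G).

(* Left Haar measure: a nonzero left-invariant Radon measure, where Radon means
   finite on compact sets, outer regular on Borel sets and inner regular on
   open sets. *)
Record is_haar_measure (R : realType) (G : topologicalGroupType)
    (mu : {measure set (borel G) -> \bar R}) : Prop := IsHaarMeasure {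
  haar_neq0 : mu [set: G] != 0%E;
  haar_left_invariant : forall (g : G) (A : set (borel G)),
    measurable A -> mu [set (g * x)%g | x in (A : set G)] = mu A;
  haar_compact_lty : forall K : set G, compact K -> (mu K < +oo)%E;
  haar_outer_regular : forall A : set (borel G), measurable A ->
    mu A = ereal_inf [set mu U | U in [set U : set G | open U /\ A `<=` U]];
  haar_inner_regular : forall U : set G, open U ->
    mu U = ereal_sup [set mu K | K in [set K : set G | compact K /\ K `<=` U]]
}.

Definition polynomial_growth_of_degree (R : realType)
    (G : topologicalGroupType) (vol : {measure set (borel G) -> \bar R})
    (d : nat) : Prop :=
  exists A : set G,
    [/\ compact A, symmetric_set A, generating_set A &
      exists a b : R, [/\ 0 < a, 0 < b &
        \forall n \near \oo,
          ((a * n%:R ^+ d)%:E <= vol (set_expg A n) <= (b * n%:R ^+ d)%:E)%E]].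

(* Main.v *)
Require Import Defs.
From HB Require Import structures.
From mathcomp Require Import all_boot all_order all_algebra.
From mathcomp Require Import all_classical all_reals all_analysis.
From mathcomp Require Import measurable_realfun.
From mathcomp Require Import ring lra zify.

Set Implicit Arguments.
Unset Strict Implicit.
Unset Printing Implicit Defensive.

Import Order.TTheory GRing.Theory Num.Theory.
Import numFieldNormedType.Exports.

Local Open Scope classical_set_scope.
Local Open Scope ring_scope.

(** Let G be the semidirect product of the plane by the integers, where 1 acts
as the rotation of angle a, and let Omega consist of a unit segment of the plane
and of the two unit steps between levels (the level of an element is its integer
coordinate).  In a word of length n that ends at level k, at least |k| letters
change the level; every other letter adds to the plane coordinate a vector of
length at most 1 whose direction, up to sign, is the angle j a, where j is the
level at which the letter is used and |j| <= n.  Hence the fibre of Omega^n over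
level k lies in (n - |k|) H_n, where H_n is the convex hull of the unit vectors
of angles j a and j a + pi with |j| <= n.

If these directions become dense, H_n fills the unit disk, and the volume of
Omega^n is equivalent to the sum over k of the areas of the disks of radius
n - |k|, that is to c n^3 with c = 2/3 of the area of the unit disk
([ratio_cvg1]).  If a is extremely close to 2 pi p / q, however, the directions
with |j| <= n stay close to the 2q-th roots of unity even for a very large n, and
H_n misses a cap of the disk.  The proportion of volume lost in this way depends
only on q ([haar_ball_capped_le], [resonance_gap]).  As eps tends to 0, there is
a scale n, depending on q, at which eps n is below this proportion; it then
suffices that a be close enough to 2 pi p / q in terms of n.  Angles with this
property for infinitely many q exist by the Baire category theorem
([exists_nearly_rational]).  They also have dense directions: if
q a = 2 pi p + h with h small, the levels that are multiples of q provide
directions spaced by h, and every vector is a combination of two neighbouring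
ones ([disk_subset_ball]).

In the convention chosen for the product, a left translation acts on every fibre
as a translation of the plane, so that a left Haar measure is the sum over the
levels of the Lebesgue measures of the fibres.  Its regularity comes from the fact
that every open set is a countable union of compact boxes. *)

(** * The semidirect product of the plane by the integers *)

Lemma continuous_pair (T U V : topologicalType) (f : T -> U) (g : T -> V) :
  continuous f -> continuous g -> continuous (fun x => (f x, g x)).
Proof. by move=> cf cg x; exact: (cvg_pair (cf x) (cg x)). Qed.

(** A point of a discrete space has a neighbourhood on which nothing varies, so
continuity can be checked with the second coordinate fixed. *)
Lemma continuous_discrete_snd (T V : topologicalType) (D : discreteTopologicalType)
    (f : T * D -> V) :
  (forall d, continuous (fun t => f (t, d))) -> continuous f.
Proof.
move=> fc [t d] A /= /(fc d t) At; exists ((fun t => f (t, d)) @^-1` A, [set d]).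
  by split => //=; exact: discrete_set1.
by move=> [t' d'] /= [At' ->].
Qed.

Lemma continuous_from_discrete (D : discreteTopologicalType) (V : topologicalType)
    (f : D -> V) : continuous f.
Proof. by move=> d A /= /nbhs_singleton Ad; apply: filterS (discrete_set1 d) => _ ->. Qed.

Section Motions.
Variable R : realType.
Implicit Types (a t : R) (v w : R * R) (k l : int).

Definition rot t v : R * R :=
  (cos t * v.1 - sin t * v.2, sin t * v.1 + cos t * v.2).

Lemma rot0 v : rot 0 v = v.
Proof. by case: v => x y; rewrite /rot/= cos0 sin0; congr pair; ring. Qed.

Lemma rotD t t' v : rot (t + t') v = rot t (rot t' v).
Proof. by rewrite /rot/= cosD sinD; congr pair; ring. Qed.

Lemma rotDv t v w : rot t (v + w) = rot t v + rot t w.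
Proof. by rewrite /rot/=; congr pair => /=; ring. Qed.

Lemma rotv0 t : rot t 0 = 0.
Proof. by rewrite /rot/= !mulr0 subrr addr0. Qed.

Lemma rotNv t v : rot t (- v) = - rot t v.
Proof. by apply/eqP; rewrite -subr_eq0 opprK -rotDv addNr rotv0. Qed.

Lemma continuous_rot t : continuous (rot t).
Proof.
move=> v; rewrite /continuous_at /rot.
apply: (@cvg_pair _ _ _ _ (nbhs (_ : R)) (nbhs (_ : R))) => /=.
  by apply: cvgB; apply: cvgM; try exact: cvg_cst; [exact: cvg_fst|exact: cvg_snd].
by apply: cvgD; apply: cvgM; try exact: cvg_cst; [exact: cvg_fst|exact: cvg_snd].
Qed.

Definition motion a : Type := (R * R * discrete_topology int)%type.

HB.instance Definition _ a :=
  Topological.copy (motion a) (R * R * discrete_topology int)%type.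
HB.instance Definition _ a := isPointed.Build (motion a) (0, 0 : int).

(** The product is the opposite of the usual one for a semidirect product: left
multiplication by (v, k) adds to the plane coordinate of an element of level l the
vector rot (l a) v, which depends on the level only. *)
Definition motion_mul a (g h : motion a) : motion a :=
  (h.1 + rot (a *~ h.2) g.1, (g.2 : int) + h.2).

Definition motion_inv a (g : motion a) : motion a :=
  (- rot (- (a *~ g.2)) g.1, - (g.2 : int)).

Definition motion_one a : motion a := (0, 0 : int).

Lemma motion_mulA a : associative (@motion_mul a).
Proof.
move=> [v k] [w l] [x m]; rewrite /motion_mul/=; congr pair.
  by rewrite rotDv -rotD -mulrzDr addrA [m + l]addrC.
by rewrite addrA.
Qed.

Lemma motion_mul1 a : left_id (motion_one a) (@motion_mul a).
Proof. by move=> [v k]; rewrite /motion_mul/= rotv0 addr0 add0r. Qed.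

Lemma motion_mulr1 a : right_id (motion_one a) (@motion_mul a).
Proof. by move=> [v k]; rewrite /motion_mul/= mulr0z rot0 add0r addr0. Qed.

Lemma motion_mulV a : left_inverse (motion_one a) (@motion_inv a) (@motion_mul a).
Proof.
move=> [v k]; rewrite /motion_mul/=.
by rewrite rotNv -rotD subrr rot0 subrr addNr.
Qed.

Lemma motion_mulrV a :
  right_inverse (motion_one a) (@motion_inv a) (@motion_mul a).
Proof. by move=> [v k]; rewrite /motion_mul/= mulrNz addNr subrr. Qed.

HB.instance Definition _ a := isGroup.Build (motion a) (@motion_mulA a)
  (@motion_mul1 a) (@motion_mulr1 a) (@motion_mulV a) (@motion_mulrV a).

Lemma motion_mul_continuous a :
  continuous (fun x : motion a * motion a => (x.1 * x.2)%g).
Proof.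
pose Z := discrete_topology int.
have fc l : continuous (fun x : motion a * (R * R) =>
    (x.2 + rot (a *~ l) x.1.1, (x.1.2 : int) + l) : motion a).
  apply: (@continuous_pair _ (R * R)%type Z) => -[[v k] w].
    apply: cvgD; first exact: cvg_snd.
    apply: (@continuous_comp _ _ _ (fun x : motion a * (R * R) => x.1.1) (rot (a *~ l))).
      by apply: (@continuous_comp _ _ _ fst fst); exact: cvg_fst.
    exact: continuous_rot.
  apply: (@continuous_comp _ Z Z (fun x : motion a * (R * R) => x.1.2)
    (fun k : Z => (k : int) + l)).
    by apply: (@continuous_comp _ _ _ fst snd); [exact: cvg_fst|exact: cvg_snd].
  exact: continuous_from_discrete.
have mul_cont : continuous (fun x : motion a * (R * R) * Z =>
    (x.1.2 + rot (a *~ x.2) x.1.1.1, (x.1.1.2 : int) + x.2) : motion a).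
  exact: continuous_discrete_snd.
move=> x; apply: (@continuous_comp _ (motion a * (R * R) * Z)%type (motion a)
  (fun x : motion a * motion a => ((x.1, x.2.1), x.2.2))
  (fun x : motion a * (R * R) * Z =>
    (x.1.2 + rot (a *~ x.2) x.1.1.1, (x.1.1.2 : int) + x.2)));
  last exact: mul_cont.
move: x; apply: continuous_pair.
  apply: continuous_pair => x; first exact: cvg_fst.
  by apply: (@continuous_comp _ _ _ snd fst); [exact: cvg_snd|exact: cvg_fst].
by move=> x; apply: (@continuous_comp _ _ _ snd snd); exact: cvg_snd.
Qed.

Lemma motion_inv_continuous a : continuous (fun x : motion a => (x^-1)%g).
Proof.
pose Z := discrete_topology int.
apply: continuous_discrete_snd => k; apply: (@continuous_pair _ (R * R)%type Z) => v.
  by apply: cvgN; exact: continuous_rot.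
exact: cvg_cst.
Qed.

HB.instance Definition _ a := isTopologicalGroup.Build (motion a)
  (@motion_mul_continuous a) (@motion_inv_continuous a).

End Motions.

(** * Planar Lebesgue measure under homotheties and translations *)

Lemma scaled_pushforward d d' (T : measurableType d) (T' : measurableType d')
    (R : realType) (mu : {measure set T -> \bar R}) (f : T -> T') (c : R) :
  measurable_fun setT f -> 0 <= c ->
  exists nu : {measure set T' -> \bar R},
    forall A, nu A = (c%:E * mu (f @^-1` A))%E.
Proof.
move=> mf c0.
unshelve eexists.
  refine (mscale (NngNum c0) (pushforward mu f)).
  exact: mf.
by move=> A.
Qed.

Section Plane.
Variable R : realType.
Local Notation leb := (@lebesgue_measure R).

Definition plane_measure := (leb \x leb)%E.
HB.instance Definition _ := Measure.on plane_measure.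

Lemma plane_measureX (A B : set (measurableTypeR R)) : measurable A -> measurable B ->
  plane_measure (A `*` B) = (leb A * leb B)%E.
Proof. exact: product_measure1E. Qed.

Lemma measurable_affine (r b : R) :
  measurable_fun [set: measurableTypeR R]
    (fun x : measurableTypeR R => r * x + b : measurableTypeR R).
Proof.
apply: continuous_measurable_fun => x; apply: cvgD; last exact: cvg_cst.
exact: mulrl_continuous.
Qed.

(** Lebesgue measure is characterized by its values on half-open intervals, whose
preimages are again half-open intervals. *)
Lemma lebesgue_affine (r b : R) (A : set (measurableTypeR R)) : 0 < r -> measurable A ->
  leb [set x | A (r * x + b)] = (r^-1%:E * leb A)%E.
Proof.
move=> r0 mA.
have [nu nuE] := scaled_pushforward leb (measurable_affine r b) (ltW r0).
have -> : leb A = nu A.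
  apply: lebesgue_measure_unique => // _ [[c d]] _ <-; rewrite nuE/=.
  rewrite [X in (_ * leb X)%E](_ : _ = `](c - b) / r, (d - b) / r]%classic); last first.
    apply/seteqP; split => x /=; rewrite !in_itv/= ltr_pdivrMr// ler_pdivlMr//.
      by rewrite ltrBlDr lerBrDr mulrC.
    by rewrite ltrBlDr lerBrDr mulrC.
  rewrite !lebesgue_measure_itv/= !lte_fin ltr_pM2r ?invr_gt0// ltrD2r.
  case: ifPn => _; last by rewrite mule0.
  by rewrite -!EFinD -EFinM; congr EFin; field; rewrite gt_eqF.
by rewrite nuE muleA -EFinM mulVf ?gt_eqF// mul1e.
Qed.

Lemma measurable_plane_affine (r : R) (v : R * R) :
  measurable_fun [set: measurableTypeR R * measurableTypeR R]
   (fun x : measurableTypeR R * measurableTypeR R =>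
     (r * x.1 + v.1, r * x.2 + v.2) : measurableTypeR R * measurableTypeR R).
Proof.
apply/measurable_fun_pairP; split => /=.
  apply: (measurableT_comp (measurable_affine r v.1)); exact: measurable_fst.
apply: (measurableT_comp (measurable_affine r v.2)); exact: measurable_snd.
Qed.

Lemma plane_measure_affine (r : R) (v : R * R)
    (A : set (measurableTypeR R * measurableTypeR R)) : 0 < r -> measurable A ->
  plane_measure [set x | A (r * x.1 + v.1, r * x.2 + v.2)] =
  ((r ^- 2)%:E * plane_measure A)%E.
Proof.
move=> r0 mA.
have [nu nuE] := scaled_pushforward plane_measure (measurable_plane_affine r v)
  (exprn_ge0 2 (ltW r0)).
have -> : plane_measure A = nu A.
  apply: product_measure_unique => // B C mB mC; rewrite nuE/=.
  rewrite [X in plane_measure X](_ : _ =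
    [set x | B (r * x + v.1)] `*` [set x | C (r * x + v.2)])//.
  have mp w D : measurable D -> measurable [set x : measurableTypeR R | D (r * x + w)].
    by move=> mD; rewrite -[X in measurable X]setTI; exact: measurable_affine.
  rewrite plane_measureX ?lebesgue_affine//; [|exact: mp|exact: mp].
  rewrite muleACA !muleA -!EFinM -muleA.
  rewrite (_ : r ^+ 2 * r^-1 * r^-1 = 1) ?mul1e//.
  by field; rewrite gt_eqF.
by rewrite nuE muleA -EFinM mulVf ?mul1e// gt_eqF// exprn_gt0.
Qed.

End Plane.

(** * Regularity of Borel measures when open sets are sigma-compact *)

Lemma geometric_series_le (R : realType) (u : nat -> \bar R) (e : R) : 0 <= e ->
  (forall i, 0 <= u i)%E -> (forall i, u i <= (e / (2 ^ i.+1)%:R)%:E)%E ->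
  (\sum_(0 <= i <oo) u i <= e%:E)%E.
Proof.
move=> e0 u0 ue; have := @epsilon_trick R (fun=> 0%E) e predT (fun=> lexx _) e0.
rewrite [X in (_ <= X + _)%E]eseries0// add0e; apply: le_trans.
by apply: lee_nneseries => // i _; rewrite add0e.
Qed.

Section Regularity.
Variables (R : realType) (G : topologicalGroupType).
Variable mu : {measure set (borel G) -> \bar R}.
Implicit Types (A : set (borel G)) (U K F W : set G).

Lemma measurable_open U : open U -> measurable (U : set (borel G)).
Proof. exact: sub_sigma_algebra. Qed.

Lemma measurable_closed F : closed F -> measurable (F : set (borel G)).
Proof.
move=> cF; rewrite -[F]setCK; apply: measurableC.
by apply: measurable_open; exact: closed_openC.
Qed.

(** Continuity from above along the differences of U and the first n sets, which
needs the finiteness of the measure of W. *)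
Lemma exhaustion_from_inside U (F : nat -> set G) W (e : \bar R) :
  open U -> (forall i, closed (F i)) -> open W -> (mu W < +oo)%E ->
  (mu ((U `\` \bigcup_i F i) `&` W) < e)%E ->
  exists n, (mu ((U `\` \big[setU/set0]_(i < n) F i) `&` W) < e)%E.
Proof.
move=> oU cF oW Woo lte.
have mF i : measurable (F i : set (borel G)) by exact: measurable_closed.
have mU := measurable_open oU; have mW := measurable_open oW.
pose E n : set (borel G) := (U `\` \big[setU/set0]_(i < n) F i) `&` W.
have mE n : measurable (E n).
  by apply: measurableI => //; apply: measurableD => //; apply: bigsetU_measurable.
have capE : \bigcap_n E n = (U `\` \bigcup_i F i) `&` W.
  apply/seteqP; split => x.
    move=> Ex; have [[Ux _] Wx] := Ex 0%N I; split => //; split => // -[i _ Fix].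
    by have [[_ +] _] := Ex i.+1 I; apply; rewrite -bigcup_mkord; exists i => /=.
  move=> [[Ux nFx] Wx] n _; split => //; split => //.
  by rewrite -bigcup_mkord => -[i _ Fix]; apply: nFx; exists i.
have : mu (E n) @[n --> \oo] --> mu (\bigcap_n E n).
  apply: nonincreasing_cvg_mu => //.
  - by apply: le_lt_trans Woo; apply: le_measure; rewrite ?inE//; exact: subIsetr.
  - exact: bigcapT_measurable.
  - move=> n m nm; apply/subsetPset; apply: setSI; apply: setDS; exact: subset_bigsetU.
rewrite capE => /(_ [set y | (y < e)%E]); case.
  by apply: open_nbhs_nbhs; split => //; exact: open_ereal_lt_ereal.
by move=> n _ /(_ n (leqnn n)) /= ?; exists n.
Qed.

Hypothesis sigma_compact_open : forall U, open U -> exists2 F : nat -> set G,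
  forall n, compact (F n) & U = \bigcup_n F n.
Hypothesis hausdorffG : hausdorff_space G.

(** Approximation from both sides inside the window W.  The closed set is there to
make the property stable under complement; outer approximation alone is not. *)
Definition squeezed W A := measurable A /\ forall e : R, 0 < e ->
  exists U F, [/\ open U, closed F, F `<=` (A : set G), (A : set G) `<=` U &
    (mu ((U `\` F) `&` W) < e%:E)%E].

(** For a countable union, the outer sets can all be kept, with errors summing to
less than e, whereas the union of the inner sets need not be closed: it is cut at a
finite stage by [exhaustion_from_inside]. *)
Lemma squeezed_sigma_algebra W : open W -> (mu W < +oo)%E ->
  sigma_algebra [set: G] [set A | squeezed W A].
Proof.
move=> oW Woo; split => [|A [mA sA]|A sA] /=.
- split => // e e0; exists set0, set0; split => //; [exact: open0|exact: closed0|].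
  by rewrite set0D set0I measure0 lte_fin.
- rewrite setTD; split; first exact: measurableC.
  move=> e /sA[U [F [oU cF FA AU lte]]]; exists (~` F), (~` U); split.
  + exact: closed_openC.
  + exact: open_closedC.
  + exact: subsetC.
  + exact: subsetC.
  + by rewrite setDE setCK [~` F `&` U]setIC -setDE.
- split; first by apply: bigcupT_measurable => i; have [] := sA i.
  move=> e e0.
  have e2 : 0 < e / 2 by rewrite divr_gt0.
  have ei i : 0 < e / 2 / (2 ^ i.+1)%:R by rewrite divr_gt0// ltr0n expn_gt0.
  have /choice[u uP] : forall i, exists UF : set G * set G,
      [/\ open UF.1, closed UF.2, UF.2 `<=` (A i : set G), (A i : set G) `<=` UF.1 &
    (mu ((UF.1 `\` UF.2) `&` W) < (e / 2 / (2 ^ i.+1)%:R)%:E)%E].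
    by move=> i; have [_ /(_ _ (ei i))[U [F UFP]]] := sA i; exists (U, F).
  pose U := \bigcup_i (u i).1.
  have oU : open U by apply: bigcup_open => i _; case: (uP i).
  have cF i : closed (u i).2 by case: (uP i).
  have oUi i : open (u i).1 by case: (uP i).
  have mi i : measurable (((u i).1 `\` (u i).2) `&` W : set (borel G)).
    apply: measurableI; last exact: measurable_open.
    by apply: measurableD; [exact: measurable_open|exact: measurable_closed].
  have := @exhaustion_from_inside U (fun i => (u i).2) W e%:E oU cF oW Woo.
  case.
    apply: (@le_lt_trans _ _ (e / 2)%:E); last first.
      by rewrite lte_fin ltr_pdivrMr// ltr_pMr// ltr1n.
    apply: le_trans
      (geometric_series_le (u := fun i => mu (((u i).1 `\` (u i).2) `&` W)) (ltW e2) _ _).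
    + apply: measure_sigma_subadditive => //.
        apply: measurableI; last exact: measurable_open.
        apply: measurableD; first exact: measurable_open.
        by apply: bigcupT_measurable => i; exact: measurable_closed.
      move=> x [[[i _ Uix] nFx] Wx]; exists i => //; split => //; split => //.
      by move=> Fix; apply: nFx; exists i.
    + by move=> i.
    + by move=> i; apply: ltW; case: (uP i).
  move=> n lte; exists U, (\big[setU/set0]_(i < n) (u i).2); split => //.
  + by apply: closed_bigsetU => i _.
  + rewrite -(bigcup_mkord n (fun i => (u i).2)) => x [i _ Fix]; exists i => //.
    by case: (uP i) => _ _ + _ _; apply.
  + by move=> x [i _ Aix]; exists i => //; case: (uP i) => _ _ _ + _; apply.
Qed.

Lemma squeezed_measurable W A : open W -> (mu W < +oo)%E -> measurable A -> squeezed W A.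
Proof.
move=> oW Woo; apply: smallest_sub; first exact: squeezed_sigma_algebra.
move=> U oU; split; first exact: measurable_open.
move=> e e0; have [F cF UF] := sigma_compact_open oU.
have cF' n : closed (F n) by apply: compact_closed.
case: (@exhaustion_from_inside U F W e%:E) => //.
  by rewrite -UF setDv set0I measure0 lte_fin.
move=> n lte; exists U, (\big[setU/set0]_(i < n) F i); split => //.
+ by apply: closed_bigsetU => i _.
+ by rewrite -bigcup_mkord UF => x [i _ Fix]; exists i.
Qed.

Variable W : nat -> set G.
Hypothesis openW : forall n, open (W n).
Hypothesis W_lty : forall n, (mu (W n) < +oo)%E.
Hypothesis W_nondecreasing : forall m n, (m <= n)%N -> W m `<=` W n.
Hypothesis W_cover : \bigcup_n W n = [set: G].

Lemma compact_measure_lty K : compact K -> (mu K < +oo)%E.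
Proof.
move=> cK; move: (cK); rewrite compact_cover => /(_ nat setT W).
case => //; first by rewrite /cover W_cover.
move=> D' _ KD; pose N := (\max_(i <- finmap.enum_fset D') i)%N.
apply: le_lt_trans (W_lty N); apply: le_measure; rewrite ?inE.
- by apply: measurable_closed; exact: compact_closed.
- exact: measurable_open.
- move=> x /KD [i /= iD Wix]; apply: W_nondecreasing Wix.
  exact: (leq_bigmax_seq i).
Qed.

(** A measure that is infinite on the whole space is treated window by window: the
open sets found in W i, with errors e / 2^(i + 1), are glued together. *)
Lemma outer_regular_measure A : measurable A ->
  mu A = ereal_inf [set mu U | U in [set U : set G | open U /\ A `<=` U]].
Proof.
move=> mA; apply/eqP; rewrite eq_le; apply/andP; split.
  apply: le_ereal_inf_tmp => _ [U [oU AU] <-].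
  by apply: le_measure; rewrite ?inE//; exact: measurable_open.
apply/lee_addgt0Pr => e e0.
have ei i : 0 < e / (2 ^ i.+1)%:R by rewrite divr_gt0// ltr0n expn_gt0.
have /choice[u uP] : forall i, exists U : set G, [/\ open U, (A : set G) `<=` U &
    (mu ((U `\` (A : set G)) `&` W i) <= (e / (2 ^ i.+1)%:R)%:E)%E].
  move=> i; have [_ /(_ _ (ei i))[U [F [oU cF FA AU lte]]]] :=
    squeezed_measurable (openW i) (W_lty i) mA.
  exists U; split => //; apply: le_trans (ltW lte).
  apply: le_measure; rewrite ?inE.
  - apply: measurableI; last exact: measurable_open.
    by apply: measurableD => //; exact: measurable_open.
  - apply: measurableI; last exact: measurable_open.
    by apply: measurableD; [exact: measurable_open|exact: measurable_closed].
  - by apply: setSI; apply: setDS.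
have mU i : measurable (u i : set (borel G)) by apply: measurable_open; case: (uP i).
have mi i : measurable ((u i `\` (A : set G)) `&` W i : set (borel G)).
  by apply: measurableI; [exact: measurableD|exact: measurable_open].
pose V := \bigcup_i (u i `&` W i).
have oV : open V by apply: bigcup_open => i _; apply: openI => //; case: (uP i).
have AV : (A : set G) `<=` V.
  move=> x Ax; have [i _ Wix] : (\bigcup_n W n) x by rewrite W_cover.
  by exists i => //; split => //; case: (uP i) => _ + _; apply.
apply: (@le_trans _ _ (mu V)); first by apply: ereal_inf_lbound; exists V.
have mV := measurable_open oV.
rewrite -(setDKU AV) measureU//; [|exact: measurableD|by rewrite setIC setDIK].
rewrite addeC leeD2l//.
apply: le_trans (geometric_series_le (u := fun i => mu ((u i `\` A) `&` W i)) (ltW e0) _ _).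
- apply: measure_sigma_subadditive => //; first exact: measurableD.
  by move=> x [[i _ [uix Wix]] nAx]; exists i.
- by move=> i.
- by move=> i; case: (uP i).
Qed.

Lemma inner_regular_measure U : open U ->
  mu U = ereal_sup [set mu K | K in [set K : set G | compact K /\ K `<=` U]].
Proof.
move=> oU; have [F cF UF] := sigma_compact_open oU.
apply/eqP; rewrite eq_le; apply/andP; split; last first.
  apply: ge_ereal_sup => _ [K [cK KU] <-].
  apply: le_measure; rewrite ?inE//; last exact: measurable_open.
  by apply: measurable_closed; exact: compact_closed.
pose E n : set (borel G) := \big[setU/set0]_(i < n) F i.
have cE n : compact (E n) by apply: bigsetU_compact.
have mE n : measurable (E n).
  by apply: measurable_closed; exact: compact_closed.
have UE : U = \bigcup_n E n.
  rewrite UF; apply/seteqP; split => x.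
    by move=> [i _ Fix]; exists i.+1 => //; rewrite /E -bigcup_mkord; exists i => /=.
  by move=> [n _]; rewrite /E -bigcup_mkord => -[i _ Fix]; exists i.
have : mu (E n) @[n --> \oo] --> mu (\bigcup_n E n).
  apply: nondecreasing_cvg_mu => //; first exact: bigcupT_measurable.
  by move=> n m nm; apply/subsetPset; exact: subset_bigsetU.
rewrite -UE => muE.
rewrite -(cvg_lim _ muE)//; apply: lime_le; first by apply/cvg_ex; exists (mu U).
apply: nearW => n; apply: ereal_sup_ubound; exists (E n) => //; split => //.
by rewrite UE => x Ex; exists n.
Qed.

End Regularity.

(** * A left Haar measure on the semidirect product *)

Lemma exchange_esum (R : realType) (T T' : choiceType) (f : T -> T' -> \bar R) :
  (forall i j, 0 <= f i j)%E ->
  (\esum_(i in [set: T]) \esum_(j in [set: T']) f i j =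
   \esum_(j in [set: T']) \esum_(i in [set: T]) f i j)%E.
Proof.
move=> f0; rewrite !esum_esum//.
rewrite (reindex_esum ([set: T'] `*`` fun=> [set: T]) _ (fun x => (x.2, x.1)))//.
by split => [[]//|[i j] [i' j'] _ _ [-> ->]//|[i j] _]; exists (j, i).
Qed.

Lemma prod_hausdorff (T U : topologicalType) :
    hausdorff_space T -> hausdorff_space U -> hausdorff_space (T * U)%type.
Proof.
move=> hT hU [x y] [x' y'] cl; congr pair.
  apply: hT => A B xA x'B.
  have [] := cl (A `*` setT) (B `*` setT).
  - by exists (A, setT) => //; split => //; exact: filterT.
  - by exists (B, setT) => //; split => //; exact: filterT.
  by move=> [z w] [[/= Az _] [Bz _]]; exists z.
apply: hU => A B yA y'B.
have [] := cl (setT `*` A) (setT `*` B).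
- by exists (setT, A) => //; split => //; exact: filterT.
- by exists (setT, B) => //; split => //; exact: filterT.
by move=> [z w] [[/= _ Aw] [_ Bw]]; exists w.
Qed.

Lemma esum_int (R : realType) (f : int -> \bar R) : (forall k, 0 <= f k)%E ->
  (\esum_(k in [set: int]) f k = \sum_(0 <= n <oo) (f (Posz n) + f (Negz n)))%E.
Proof.
move=> f0; rewrite nneseries_esumT => [|n]; last exact: adde_ge0.
rewrite esumD// (esumID (range Posz))// !setTI; congr (_ + _)%E.
  rewrite (reindex_esum [set: nat] _ Posz)//.
  by split => [n _|m n _ _ []//|_ [n _ <-]]; exists n.
rewrite (reindex_esum [set: nat] _ Negz)//.
split => [n _|m n _ _ []//|[n|n] /=]; first by case.
- by case; exists n.
- by move=> _; exists n.
Qed.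

Lemma esum_int_finite (R : realType) (f : int -> \bar R) N :
  (forall k, 0 <= f k)%E -> (forall k, (N <= `|k|)%N -> f k = 0%E) ->
  (\esum_(k in [set: int]) f k = \sum_(0 <= n < N) (f (Posz n) + f (Negz n)))%E.
Proof.
move=> f0 fN; rewrite esum_int// (@nneseries_split _ _ 0%N N)/= => [|n _]; last exact: adde_ge0.
rewrite add0n [X in (_ + X)%E]eseries0 ?adde0// => n Nn _.
by rewrite !fN ?adde0//= leqW.
Qed.

Lemma open_setX (T U : topologicalType) (A : set T) (B : set U) :
  open A -> open B -> open (A `*` B).
Proof.
move=> oA oB; rewrite openE => -[x y] [/= Ax By]; exists (A, B) => //.
by split; apply: open_nbhs_nbhs.
Qed.

Section HaarMeasure.
Variables (R : realType) (a : R).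
Local Notation plane := (measurableTypeR R * measurableTypeR R)%type.
Local Notation G := (motion a).
Implicit Types (A : set (borel (motion a))) (k : int).

Definition fiber (A : set G) k : set plane := [set x | A (x, k)].

Lemma motion_hausdorff : hausdorff_space G.
Proof.
apply: prod_hausdorff; last exact: discrete_hausdorff.
by apply: prod_hausdorff; exact: Rhausdorff.
Qed.

(** Rational parameters make the boxes countably many. *)
Definition box (i : rat * rat * rat * int) : set G :=
  let: (p, q, e, k) := i in
  (`[ratr p - ratr e, ratr p + ratr e] `*` `[ratr q - ratr e, ratr q + ratr e])
  `*` [set k].

Lemma compact_box i : compact (box i).
Proof.
case: i => [[[p q] e] k]; apply: compact_setX; last exact: compact_set1.
by apply: compact_setX; exact: segment_compact.
Qed.

Lemma measurable_fiber_box i k : measurable (fiber (box i) k).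
Proof.
case: i => [[[p q] e] l]; have [->|kl] := eqVneq k l.
  rewrite (_ : fiber _ _ = `[ratr p - ratr e, ratr p + ratr e] `*`
    `[ratr q - ratr e, ratr q + ratr e]).
    by apply: measurableX; exact: measurable_itv.
  by apply/seteqP; split => x /= => [[]|].
rewrite (_ : fiber _ _ = set0)//.
by apply/seteqP; split => x //= [_] /= /eqP; rewrite (negbTE kl).
Qed.

Lemma nbhs_box (g : G) (U : set G) : nbhs g U -> exists2 i, box i g & box i `<=` U.
Proof.
case: g => [[x y] k] [[P Q] /= [[[A B] [/= xA yB] ABP] kQ] PQU].
have [d1 /= d10 xdA] := (nbhs_ballP _ _).1 xA.
have [d2 /= d20 ydB] := (nbhs_ballP _ _).1 yB.
pose d := Num.min d1 d2.
have d0 : 0 < d by rewrite lt_min d10.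
have [e] := rat_in_itvoo (divr_gt0 d0 (@ltr0n R 2)).
rewrite in_itv/= => /andP[e0 ed].
have close (z : R) : exists p : rat, z - ratr e < ratr p < z + ratr e.
  have /rat_in_itvoo[p] : z - ratr e < z + ratr e by lra.
  by rewrite in_itv/=; exists p.
have [p /andP[p1 p2]] := close x; have [q /andP[q1 q2]] := close y.
exists (p, q, e, k) => /=.
  by do !split => //=; rewrite in_itv/=; apply/andP; split; lra.
have dd1 : d <= d1 by rewrite ge_min lexx.
have dd2 : d <= d2 by rewrite ge_min lexx orbT.
move=> [[x' y'] k'] [[/=]]; rewrite !in_itv/= => /andP[h1 h2] /andP[h3 h4] ->.
apply: PQU; split => /=; last exact: nbhs_singleton kQ.
apply: ABP; split => /=.
  by apply: xdA; rewrite /ball/= ltr_distlC; apply/andP; split; lra.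
by apply: ydB; rewrite /ball/= ltr_distlC; apply/andP; split; lra.
Qed.

(** The boxes contained in an open set cover it.  This one fact makes fibres of Borel
sets measurable and open sets sigma-compact. *)
Lemma open_bigcup_box (U : set G) : open U -> exists2 F : nat -> set G,
  forall n, compact (F n) /\ (forall k, measurable (fiber (F n) k)) & U = \bigcup_n F n.
Proof.
move=> oU.
exists (fun n => if unpickle n is Some i then
    if asbool (box i `<=` U) then box i else set0 else set0) => [n|].
  case: unpickle => [i|]; [case: ifPn => _|].
  - by split; [exact: compact_box|move=> k; exact: measurable_fiber_box].
  - by split; [exact: compact0|move=> k; exact: measurable0].
  - by split; [exact: compact0|move=> k; exact: measurable0].
apply/seteqP; split => [g Ug|g [n _]].
  have [i ig iU] := nbhs_box (open_nbhs_nbhs (conj oU Ug)).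
  by exists (pickle i); [exact: I|rewrite pickleK; case: asboolP].
by case: unpickle => [i|//]; case: asboolP => // iU /iU.
Qed.

(** The embedding of the plane as a level is measurable: the preimage of an open set
is a countable union of rectangles. *)
Lemma measurable_fiber A k : measurable A -> measurable (fiber A k).
Proof.
have mf : measurable_fun [set: plane] (fun x : plane => (x, k) : borel G).
  apply: (@measurability _ _ plane (borel G) setT _ (@open G)) => // _ [U oU <-]; rewrite setTI.
  have [F /all_and2[_ mF] UF] := open_bigcup_box oU.
  rewrite (_ : _ @^-1` _ = \bigcup_n fiber (F n) k).
    by apply: bigcupT_measurable => n; exact: mF.
  by rewrite UF; apply/seteqP; split => x.
by move=> mA; rewrite -[X in measurable X]setTI; exact: mf.
Qed.

Definition haar A : \bar R :=
  (\esum_(k in [set: int]) @plane_measure R (fiber A k))%E.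

Let haar0 : haar set0 = 0%E.
Proof.
rewrite /haar esum1// => k _; rewrite (_ : fiber _ _ = set0) ?measure0//.
Qed.

Let haar_ge0 A : (0 <= haar A)%E.
Proof. by apply: esum_ge0. Qed.

Let haar_sigma_additive : semi_sigma_additive haar.
Proof.
move=> F mF tF _.
have mFk n k : measurable (fiber (F n) k) by exact: measurable_fiber.
have -> : haar (\bigcup_n F n) = (\sum_(0 <= n <oo) haar (F n))%E.
  rewrite nneseries_esumT// /haar exchange_esum//; apply: eq_esum => k _.
  rewrite -nneseries_esumT// (_ : fiber _ _ = \bigcup_n fiber (F n) k)//.
  rewrite measure_semi_bigcup//; last exact: bigcupT_measurable.
  move=> i j _ _ [x [Fix Fjx]]; apply: (tF i j) => //; by exists (x, k).
by apply: is_cvg_ereal_nneg_natsum_cond => n _ _; exact: haar_ge0.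
Qed.

HB.instance Definition _ := isMeasure.Build _ _ _ haar haar0 haar_ge0 haar_sigma_additive.


Lemma haar_neq0 : haar [set: borel G] != 0%E.
Proof.
suff : (0 < haar [set: borel G])%E by move/gt_eqF ->.
pose Q : set plane := `[0, 1] `*` `[0, 1].
have mQ : measurable Q by apply: measurableX; exact: measurable_itv.
apply: (@lt_le_trans _ _ (plane_measure Q)).
  rewrite plane_measureX; [|exact: measurable_itv|exact: measurable_itv].
  by rewrite !lebesgue_measure_itv/= lte_fin ltr01 oppr0 adde0 mule1 lte_fin.
apply: esum_ge; exists [set 0]; first by split => //; exact: finite_set1.
rewrite fsbig_set1; apply: le_measure; rewrite ?inE//.
exact: (measurable_fiber 0 measurableT).
Qed.

(** Left multiplication translates every fibre and shifts the levels. *)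
Lemma haar_invariant (g : G) A : measurable A ->
  haar [set (g * x)%g | x in (A : set G)] = haar A.
Proof.
move=> mA; case: g => v k0.
have bij : set_bij [set: int] [set: int] (fun l => k0 + l).
  split => // [l m _ _ /addrI//|k _]; exists (k - k0) => //; lia.
rewrite /haar (reindex_esum [set: int] _ _ _ bij); apply: eq_esum => l _.
set w := rot (a *~ l) v.
rewrite (_ : fiber _ _ = [set x | fiber A l (1 * x.1 + (- w).1, 1 * x.2 + (- w).2)]).
  rewrite plane_measure_affine; [|exact: ltr01|exact: measurable_fiber].
  by rewrite expr1n invr1 mul1e.

apply/seteqP; split => x /=.
  move=> [[y m] Ay [/= <- /addrI/= ml]]; rewrite /fiber/= !mul1r -/w -[l]ml.
  by rewrite !addrK; case: y Ay.
move=> Ax; exists (x - w, l) => //.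
  by move: Ax; rewrite /fiber/= !mul1r; case: x.
by congr pair; rewrite subrK.
Qed.

Definition window n : set G :=
  (`]- n%:R, n%:R[ `*` `]- n%:R, n%:R[) `*`
  [set k : discrete_topology int | (`|k : int| < n)%N].

Lemma open_window n : open (window n).
Proof.
apply: open_setX; last exact: discrete_open.
by apply: open_setX; exact: interval_open.
Qed.

Lemma window_nondecreasing m n : (m <= n)%N -> window m `<=` window n.
Proof.
move=> mn [[x y] k] [[/=]]; rewrite !in_itv/= => /andP[h1 h2] /andP[h3 h4] h5.
have mnR : m%:R <= n%:R :> R by rewrite ler_nat.
split; [split|]; rewrite /= ?in_itv/=; [apply/andP; split; lra..|exact: leq_trans mn].
Qed.

Lemma window_cover : \bigcup_n window n = [set: G].
Proof.
apply/seteqP; split => // -[[x y] k] _.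
pose N := (Num.bound `|x| + Num.bound `|y| + `|k : int|).+1.
have h (z : R) : (Num.bound `|z| < N)%N -> - N%:R < z < N%:R.
  move=> zN; rewrite -ltr_norml (lt_le_trans (archi_boundP (normr_ge0 z)))//.
  by rewrite ler_nat ltnW.
exists N => //; split; [split|] => /=; rewrite ?in_itv/=.
- by apply: h; rewrite /N; lia.
- by apply: h; rewrite /N; lia.
- by rewrite /N; lia.
Qed.

Lemma window_lty n : (haar (window n) < +oo)%E.
Proof.
rewrite /haar (@esum_int_finite _ _ n)//; last first.
  move=> k nk; rewrite (_ : fiber _ _ = set0) ?measure0//.
  by apply/seteqP; split => // x [_] /=; rewrite ltnNge nk.
apply: lte_sum_pinfty => i _.
have h k : (plane_measure (fiber (window n) k) < +oo)%E.
  apply: (@le_lt_trans _ _ (plane_measure (`]- n%:R, n%:R[ `*` `]- n%:R, n%:R[)%classic)).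
    apply: le_measure; rewrite ?inE.
    - by apply: measurable_fiber; apply: measurable_open; exact: open_window.
    - by apply: measurableX; exact: measurable_itv.
    - by move=> x [].
  rewrite plane_measureX; [|exact: measurable_itv|exact: measurable_itv].
  rewrite !lebesgue_measure_itv/=; case: ifP => _; last by rewrite mule0.
  by rewrite -EFinB -EFinM ltry.
by rewrite lte_add_pinfty.
Qed.

Lemma open_sigma_compact (U : set G) : open U -> exists2 F : nat -> set G,
  forall n, compact (F n) & U = \bigcup_n F n.
Proof. by move=> /open_bigcup_box[F FP UF]; exists F => // n; have [] := FP n. Qed.

Lemma haar_is_haar_measure : is_haar_measure haar.
Proof.
split.
- exact: haar_neq0.
- exact: haar_invariant.
- exact: (compact_measure_lty motion_hausdorff open_window window_lty
    window_nondecreasing window_cover).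
- exact: (outer_regular_measure open_sigma_compact motion_hausdorff open_window window_lty
    window_cover).
- exact: (inner_regular_measure haar open_sigma_compact motion_hausdorff).
Qed.

Lemma motion_locally_compact : locally_compact_group G.
Proof.
split; first exact: motion_hausdorff.
move=> [[x y] k] _; rewrite withinET.
pose K : set G := (`[x - 1, x + 1] `*` `[y - 1, y + 1]) `*` [set k].
have cK : compact K.
  by apply: compact_setX; [apply: compact_setX; exact: segment_compact|exact: compact_set1].
exists K; last by split => //; exact: (compact_closed motion_hausdorff).
have itv_nbhs (z : R) : nbhs z `[z - 1, z + 1]%classic.
  have -> : `[z - 1, z + 1]%classic = closed_ball z 1 by rewrite closed_ball_itv.
  by apply/nbhs_closedballP; exists 1%:pos.
exists (`[x - 1, x + 1] `*` `[y - 1, y + 1], [set k]) => //.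
split; last exact: discrete_set1.
by exists (`[x - 1, x + 1]%classic, `[y - 1, y + 1]%classic).
Qed.

End HaarMeasure.

(** * Disks and disks without a cap *)

Section Disk.
Variable R : realType.
Implicit Types (z : R * R) (r b : R).
Local Notation plane := (measurableTypeR R * measurableTypeR R)%type.

Definition proj b z : R := z.1 * cos b + z.2 * sin b.

(** The disk is described by its supporting half-planes: bounds on words are bounds on
linear forms, which add up along the word. *)
Definition disk r : set plane := [set z | forall b, proj b z <= r].

Lemma projD b z w : proj b (z + w) = proj b z + proj b w.
Proof. by rewrite /proj/=; ring. Qed.

Lemma proj_rot b t r : proj b (rot t (r, 0)) = r * cos (t - b).
Proof. by rewrite /proj/rot/= cosB; ring. Qed.

Lemma polar_coordinates z :
  exists r b, [/\ 0 <= r, - pi <= b <= pi & z = (r * cos b, r * sin b)].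
Proof.
case: z => x y; pose r := Num.sqrt (x ^+ 2 + y ^+ 2).
have r2 : r ^+ 2 = x ^+ 2 + y ^+ 2 by rewrite sqr_sqrtr// addr_ge0// sqr_ge0.
have r0 : 0 <= r by rewrite sqrtr_ge0.
have pi0 := pi_ge0 R.
have [rE|rN0] := eqVneq r 0.
  exists 0, 0; split => //; first by apply/andP; split; lra.
  move: r2; rewrite rE expr0n/= => /esym/eqP; rewrite paddr_eq0 ?sqr_ge0//.
  by rewrite !sqrf_eq0 => /andP[/eqP -> /eqP ->]; rewrite !mul0r.
have rp : 0 < r by rewrite lt_neqAle eq_sym rN0.
have c2 : (x / r) ^+ 2 + (y / r) ^+ 2 = 1.
  by rewrite !expr_div_n -mulrDl -r2 divff// sqrf_eq0.
have c1 : -1 <= x / r <= 1.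
  by rewrite -ler_norml -(@expr_le1 _ 2)// real_normK ?num_real// -c2 lerDl sqr_ge0.
have s1 : Num.sqrt (1 - (x / r) ^+ 2) = `|y| / r.
  rewrite -c2 [X in X - _]addrC addrK sqrtr_sqr normrM [`|r^-1|]ger0_norm//.
  by rewrite invr_ge0.
have acp := acos_def c1.
have [y0|y0] := lerP 0 y.
  exists r, (acos (x / r)); split => //.
    by have [/andP[h1 h2] _] := acp; apply/andP; split; lra.
  rewrite acosK ?in_itv//= sin_acos// s1 ger0_norm//.
  by congr pair; rewrite mulrC divfK.
exists r, (- acos (x / r)); split => //.
  by have [/andP[h1 h2] _] := acp; apply/andP; split; lra.
rewrite cosN sinN acosK ?in_itv//= sin_acos// s1 ltr0_norm// mulrN mulNr mulrN opprK.
by congr pair; rewrite mulrC divfK.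
Qed.

Lemma closed_disk r : closed (disk r).
Proof.
rewrite (_ : disk r = \bigcap_b [set z : R * R | proj b z <= r]); last first.
  by apply/seteqP; split => z /= h b; [move=> _; exact: h|exact: h b I].
apply: closed_bigI => b _.
apply: (@closed_comp _ _ (proj b) [set y | y <= r]); last exact: closed_le.
move=> z _; apply: cvgD; apply: cvgM; try exact: cvg_cst; [exact: cvg_fst|exact: cvg_snd].
Qed.

Lemma measurable_disk r : measurable (disk r).
Proof.
have cD : closed ([set g | disk r g.1] : set (motion (0 : R))).
  apply: (@closed_comp (motion (0 : R)) _ fst (disk r)); last exact: closed_disk.
  by move=> g _; exact: cvg_fst.
exact: (measurable_fiber 0 (measurable_closed cD)).
Qed.

Definition disk_area : R := fine (plane_measure (disk 1)).

Lemma disk_areaE : plane_measure (disk 1) = disk_area%:E /\ 0 < disk_area.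
Proof.
have lower : ((1%:E : \bar R) <= plane_measure (disk 1))%E.
  pose Q : set plane := `[-(1/2), 1/2] `*` `[-(1/2), 1/2].
  have mQ : measurable Q by apply: measurableX; exact: measurable_itv.
  have -> : 1%:E = plane_measure Q.
    rewrite plane_measureX; [|exact: measurable_itv|exact: measurable_itv].
    rewrite !lebesgue_measure_itv/= lte_fin ifT; last by lra.
    by rewrite -EFinB -EFinM; congr EFin; lra.
  apply: le_measure; rewrite ?inE//; first exact: measurable_disk.
  move=> [x y] [/=]; rewrite !in_itv/= -!ler_norml => hx hy b; rewrite /proj/=.
  have : `|x * cos b| <= 1/2 * 1 by rewrite normrM ler_pM ?cos_max.
  have : `|y * sin b| <= 1/2 * 1 by rewrite normrM ler_pM ?sin_max.
  by rewrite !ler_norml; lra.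
have upper : (plane_measure (disk 1) < +oo)%E.
  pose Q : set plane := `[-1, 1] `*` `[-1, 1].
  have mQ : measurable Q by apply: measurableX; exact: measurable_itv.
  apply: (@le_lt_trans _ _ (plane_measure Q)).
    apply: le_measure; rewrite ?inE//; first exact: measurable_disk.
    move=> [x y] h; split; rewrite /= in_itv/=; apply/andP; split.
    - by have := h pi; rewrite /proj/= cospi sinpi; lra.
    - by have := h 0; rewrite /proj/= cos0 sin0; lra.
    - by have := h (- (pi / 2)); rewrite /proj/= cosN sinN cos_pihalf sin_pihalf; lra.
    - by have := h (pi / 2); rewrite /proj/= cos_pihalf sin_pihalf; lra.
  rewrite plane_measureX; [|exact: measurable_itv|exact: measurable_itv].
  rewrite !lebesgue_measure_itv/= lte_fin ifT; last by lra.
  by rewrite -EFinB -EFinM ltry.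
have fin : plane_measure (disk 1) \is a fin_num.
  by rewrite ge0_fin_numE.
split; first by rewrite fineK.
by rewrite -lte_fin fineK//; apply: lt_le_trans lower; rewrite lte_fin.
Qed.

Lemma disk_area_gt0 : 0 < disk_area. Proof. by case: disk_areaE. Qed.

Lemma measure_translated_disk r (c : R * R) : 0 < r ->
  plane_measure [set z : plane | disk r (z - c)] = (r ^+ 2 * disk_area)%:E.
Proof.
move=> r0; rewrite EFinM -disk_areaE.1.
have rV0 : 0 < r^-1 by rewrite invr_gt0.
have := plane_measure_affine (- r^-1 * c.1, - r^-1 * c.2) rV0 (measurable_disk 1).
rewrite exprVn invrK => <-; congr plane_measure.
have projE z b : proj b (r^-1 * z.1 - r^-1 * c.1, r^-1 * z.2 - r^-1 * c.2) =
    r^-1 * proj b (z - c) by rewrite /proj/=; ring.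
apply/seteqP; split => z /= h b; have := h b; rewrite !mulNr projE.
  by rewrite -[X in _ -> _ <= X](mulVf (lt0r_neq0 r0)) ler_pM2l.
by rewrite -[X in _ <= X -> _](mulVf (lt0r_neq0 r0)) ler_pM2l.
Qed.

Lemma measure_disk r : 0 <= r -> plane_measure (disk r) = (r ^+ 2 * disk_area)%:E.
Proof.
rewrite le_eqVlt => /predU1P[<-|r0]; last first.
  rewrite -(measure_translated_disk 0 r0); congr plane_measure.
  by apply/seteqP; split => z /=; rewrite subr0.
rewrite expr0n mul0r; apply/eqP; rewrite eq_le measure_ge0 andbT.
have Q0 : plane_measure ([set 0] `*` [set 0] : set plane) = 0%E.
  by rewrite plane_measureX ?measurable_set1// lebesgue_measure_set1 mul0e.
rewrite -[X in (_ <= X)%E]Q0; apply: le_measure; rewrite ?inE; first exact: measurable_disk.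
  by apply: measurableX; exact: measurable_set1.
move=> [x y] h; split; apply/eqP; rewrite eq_le; apply/andP; split => /=.
- by have := h 0; rewrite /proj/= cos0 sin0; lra.
- by have := h pi; rewrite /proj/= cospi sinpi; lra.
- by have := h (pi / 2); rewrite /proj/= cos_pihalf sin_pihalf; lra.
- by have := h (- (pi / 2)); rewrite /proj/= cosN sinN cos_pihalf sin_pihalf; lra.
Qed.

(** The cap that E misses contains a disk of radius w r / 3, centred at distance
(1 - w / 2) r from the origin in the direction b. *)
Lemma measure_capped_disk r b w (E : set plane) : 0 <= r -> 0 < w <= 1 ->
  measurable E -> E `<=` disk r -> (forall z, E z -> proj b z <= (1 - w) * r) ->
  (plane_measure E <= ((1 - w ^+ 2 / 9) * r ^+ 2 * disk_area)%:E)%E.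
Proof.
rewrite le_eqVlt => /predU1P[<- _ mE Er _|r0 /andP[w0 w1] mE Er Eb].
  rewrite expr0n mulr0 mul0r.
  have := @measure_disk 0 (lexx _); rewrite expr0n mul0r => <-.
  by apply: le_measure; rewrite ?inE//; exact: measurable_disk.
pose s := w * r / 3; have s0 : 0 < s by rewrite divr_gt0// mulr_gt0.
pose c : R * R := ((1 - w / 2) * r * cos b, (1 - w / 2) * r * sin b).
pose B : set plane := [set z | disk s (z - c)].
have mB : measurable B.
  rewrite (_ : B = [set x | disk s (1 * x.1 + (- c).1, 1 * x.2 + (- c).2)]).
    rewrite -[X in measurable X]setTI.
    by apply: (measurable_plane_affine 1 (- c)) => //; exact: measurable_disk.
  by apply/seteqP; split => z /=; rewrite /B/= !mul1r.
have projc b' : proj b' c = (1 - w / 2) * r * cos (b - b').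
  by rewrite /proj/c/= cosB; ring.
have BE : B `&` E = set0.
  apply/seteqP; split => // z [Bz Ez].
  (* The half-plane of B facing away from b, against the cap condition. *)
  have := Eb _ Ez; have := Bz (b + pi).
  rewrite projD /proj/= cosDpi sinDpi.
  have := projc b; rewrite subrr cos0 /proj/= => h.
  have wr : 0 < w * r by rewrite mulr_gt0.
  rewrite /s; nra.
have BD : B `<=` disk r.
  move=> z Bz b'; have := Bz b'; rewrite -[in X in _ -> X](subrK c z) !projD projc.
  have := cos_le1 (b - b') => c1.
  have : (1 - w / 2) * r * cos (b - b') <= (1 - w / 2) * r * 1.
    by rewrite ler_pM2l// mulr_gt0//; lra.
  have wr : 0 < w * r by rewrite mulr_gt0.
  rewrite /s; lra.
have := measure_disk (ltW r0) => Dr.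
have : (plane_measure B + plane_measure E <= plane_measure (disk r))%E.
  rewrite -measureU//; apply: le_measure; rewrite ?inE; first exact: measurableU.
    exact: measurable_disk.
  by rewrite subUset.
rewrite measure_translated_disk// Dr.
have Efin : plane_measure E \is a fin_num.
  rewrite ge0_fin_numE//; apply: (@le_lt_trans _ _ (plane_measure (disk r))).
    by apply: le_measure; rewrite ?inE//; exact: measurable_disk.
  by rewrite Dr ltry.
rewrite -(fineK Efin) -EFinD !lee_fin => h.
rewrite -lerBrDl in h; apply: le_trans h _.
by rewrite le_eqVlt; apply/orP; left; apply/eqP; rewrite /s; field.
Qed.

End Disk.

(** * Balls of the word metric *)

Section SetPowers.
Variable G : topologicalGroupType.
Implicit Types A : set G.

Lemma set_expgS A n : set_expg A n.+1 = set_mulg A (set_expg A n).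
Proof. by []. Qed.

Lemma compact_set_expg A n : compact A -> compact (set_expg A n).
Proof.
move=> cA; elim: n => [|n cAn]; first exact: compact_set1.
rewrite set_expgS.
have -> : set_mulg A (set_expg A n) =
    (fun x : G * G => (x.1 * x.2)%g) @` (A `*` set_expg A n).
  apply/seteqP; split => [_ [x Ax [y Ay <-]]|_ [[x y] [/= Ax Ay] <-]].
    by exists (x, y).
  by exists x => //; exists y.
apply: continuous_compact; last exact: compact_setX.
by apply: continuous_subspaceT => x; exact: mulg_continuous.
Qed.

Lemma set_expg_le A m n : A 1%g -> (m <= n)%N -> set_expg A m `<=` set_expg A n.
Proof.
move=> A1; elim: n => [|n IH]; first by rewrite leqn0 => /eqP ->.
rewrite leq_eqVlt => /predU1P[->//|/IH] Amn g /Amn An.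
by exists 1%g => //; exists g => //; rewrite mul1g.
Qed.

Lemma set_expg_subgroup A H n : is_subgroup H -> A `<=` H -> set_expg A n `<=` H.
Proof.
move=> [H1 Hdiv] AH; elim: n => [_ -> //|n IH _ [x /AH Hx [y /IH Hy <-]]].
by have := Hdiv _ _ Hx (Hdiv _ _ H1 Hy); rewrite mul1g invgK.
Qed.

End SetPowers.

Section Balls.
Variables (R : realType) (a : R).
Local Notation G := (motion a).
Implicit Types (k l : int) (n : nat) (r s t b : R).

Definition generators : set G :=
  [set ((t, 0), 0 : int) | t in `[-1, 1]] `|` [set (0, 1 : int)]
  `|` [set (0, -1 : int)].

Local Notation ball n := (set_expg generators n).

Lemma generators_segment t : `|t| <= 1 -> generators ((t, 0), 0 : int).
Proof. by rewrite ler_norml => ht; left; left; exists t; rewrite //= in_itv. Qed.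

Lemma generators1 : generators 1%g.
Proof. by apply: (@generators_segment 0); rewrite normr0. Qed.

Lemma compact_generators : compact generators.
Proof.
have cG (g : G) : compact [set g] by exact: compact_set1.
apply: compactU => //; apply: compactU => //.
apply: continuous_compact; last exact: segment_compact.
apply: continuous_subspaceT.
apply: (@continuous_pair R (R * R)%type (discrete_topology int)).
  by apply: (@continuous_pair R R R) => t; [exact: cvg_id|exact: cvg_cst].
by move=> t; exact: cvg_cst.
Qed.

Lemma symmetric_generators : symmetric_set generators.
Proof.
have E v k : (((v, k) : G)^-1)%g = (- rot (- (a *~ k)) v, - k : int) :> G by [].
move=> _ [[[t t1 <-]|->]|->]; rewrite E ?rotv0 ?oppr0.
- rewrite rot0.
  have -> : - (t, 0) = (- t, 0) :> R * R by congr pair; rewrite /= oppr0.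
  by apply: generators_segment; move: t1; rewrite /= in_itv/= -ler_norml normrN.
- by right.
- by left; right; rewrite opprK.
Qed.

(** Upper bound for balls.  A letter of the segment used at level j moves the projection
in the direction b by at most |cos (j a - b)|, and |k| letters at least are spent on
changing the level. *)
Lemma ball_proj_le n b c : 0 <= c ->
  (forall j : int, (`|j| <= n)%N -> `|cos (a *~ j - b)| <= c) ->
  forall (z : R * R) k, ball n (z, k) ->
  (`|k| <= n)%N /\ proj b z <= c * (n%:R - `|k|%:R).
Proof.
move=> c0; elim: n => [|n IH] hc z k.
  by move=> [-> ->]; split => //; rewrite /proj/= subrr; lra.
have hc' j : (`|j| <= n)%N -> `|cos (a *~ j - b)| <= c.
  by move=> jn; apply: hc; exact: leqW.
move=> [g gG [[w m] /(IH hc')[mn pw] /= []]].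
have move_level (k' : int) : `|k'| = 1%N -> (`|(k' + m)%R| <= n.+1)%N /\
    proj b w <= c * (n.+1%:R - `|(k' + m)%R|%:R).
  move=> k'1; have km : (`|(k' + m)%R| <= `|m| + 1)%N by lia.
  split; first by lia.
  apply: le_trans pw _; rewrite ler_wpM2l//.
  have : `|(k' + m)%R|%:R <= (`|m| + 1)%:R :> R by rewrite ler_nat.
  by rewrite natrD -[n.+1%:R]natr1; lra.
case: gG => [[[t]|->]|->] /=; last 2 first.
- by rewrite rotv0 addr0 => <- <-; exact: move_level.
- by rewrite rotv0 addr0 => <- <-; exact: move_level.
rewrite in_itv/= -ler_norml => t1 <- /= <- <-; rewrite add0r; split; first exact: leqW.
rewrite projD proj_rot.
have : t * cos (a *~ m - b) <= c.
  apply: le_trans (ler_norm _) _; rewrite normrM -[c]mul1r.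
  by apply: ler_pM => //; apply: hc; exact: leqW.
by rewrite -natr1; lra.
Qed.

Lemma ball_disk n (z : R * R) k : ball n (z, k) ->
  (`|k| <= n)%N /\ disk (n%:R - `|k|%:R) z.
Proof.
move=> zk; have h b := @ball_proj_le n b 1 ler01 (fun j _ => cos_max _) z k zk.
by split; [case: (h 0)|move=> b; have [_] := h b; rewrite mul1r].
Qed.

Lemma ball_climb n k l (z : R * R) :
  ball n (z, k) -> ball (n + `|(l - k)%R|) (z, l).
Proof.
move: {-2}(`|(l - k)%R|)%N (erefl `|(l - k)%R|%N) => m.
elim: m l => [|m IH] l lk zk; first by rewrite addn0 (_ : l = k)//; lia.
have step (e : int) : (e = 1) \/ (e = -1) -> `|(l - e - k)%R|%N = m -> ball (n + m.+1) (z, l).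
  move=> eE lek; rewrite addnS; exists (0, e : int).
    by case: eE => ->; [left; right|right].
  exists (z, l - e); first by apply: IH.
  by congr pair => /=; [rewrite rotv0 addr0|lia].
case: (leP k l) => kl.
  by apply: (step 1); [left|lia].
by apply: (step (-1)); [right|lia].
Qed.

Lemma ball_stretch n p k s (z : R * R) : `|s| <= p%:R ->
  ball n (z, k) -> ball (n + p) (z + rot (a *~ k) (s, 0), k).
Proof.
move=> sp zk.
case: p sp => [|p] sp.
  have -> : s = 0 by apply/eqP; rewrite -normr_le0.
  by rewrite rotv0 addr0 addn0.
pose t := s / p.+1%:R.
have t1 : `|t| <= 1.
  by rewrite normrM normfV normr_nat ler_pdivrMr ?ltr0n// mul1r.
have -> : s = t * p.+1%:R by rewrite divfK// pnatr_eq0.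
elim: p.+1 => [|q IH]; first by rewrite mulr0 rotv0 addr0 addn0.
rewrite addnS; exists ((t, 0), 0 : int); first exact: generators_segment.
exists (z + rot (a *~ k) (t * q%:R, 0), k) => //.
congr pair => /=; last by rewrite add0r.
rewrite -addrA -rotDv; congr (_ + rot _ _); congr pair => /=; last by rewrite addr0.
by rewrite -natr1; ring.
Qed.

(** The word walks to level l, uses segment letters there, walks to level l', uses
segment letters there, and walks to level k.  The constant 2 pays for rounding up the
numbers of segment letters used at the two levels. *)
Lemma ball_two_directions n k l l' s s' :
  `|s| + `|s'| + (`|l| + `|(l' - l)%R| + `|(k - l')%R| + 2)%N%:R <= n%:R ->
  ball n (rot (a *~ l) (s, 0) + rot (a *~ l') (s', 0), k).
Proof.
move=> hn.
have ceil r : 0 <= r -> exists2 p : nat, r <= p%:R & p%:R <= r + 1.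
  move=> r0; exists (Num.trunc r).+1; last by rewrite -natr1 lerD2r truncn_le.
  by apply: ltW; rewrite truncnS_gt.
have [p sp ps] := ceil `|s| (normr_ge0 s).
have [p' sp' ps'] := ceil `|s'| (normr_ge0 s').
have start : ball 0 (0, 0 : int) by [].
have := ball_climb k (ball_stretch sp' (ball_climb l' (ball_stretch sp (ball_climb l start)))).
rewrite subr0 add0n add0r; apply: set_expg_le; first exact: generators1.
rewrite -(ler_nat R); apply: le_trans hn.
by move: ps ps'; rewrite !natrD; lra.
Qed.

End Balls.

(** * Angles close to a rational multiple of 2 pi *)

Section Trigonometry.
Variable R : realType.
Implicit Types (x y h : R) (m : int).

Lemma cos_periodic x m : cos (x + pi *+ 2 *~ m) = cos x.
Proof.
case: m => n; first exact: (periodicn (@cosD2pi R)).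
rewrite NegzE mulrNz -[LHS](periodicn (@cosD2pi R) n.+1); congr cos.
by rewrite -addrA addNr addr0.
Qed.

Lemma sin_periodic x m : sin (x + pi *+ 2 *~ m) = sin x.
Proof.
case: m => n; first exact: (periodicn (@sinD2pi R)).
rewrite NegzE mulrNz -[LHS](periodicn (@sinD2pi R) n.+1); congr sin.
by rewrite -addrA addNr addr0.
Qed.

Lemma normr_sin_mulrn_le y n : `|sin (y *+ n)| <= n%:R * `|sin y|.
Proof.
elim: n => [|n IH]; first by rewrite mulr0n sin0 normr0 mul0r.
rewrite mulrSr sinD -natr1 mulrDl mul1r.
apply: le_trans (ler_normD _ _) _; rewrite !normrM; apply: lerD.
  by apply: le_trans IH; rewrite ler_piMr ?cos_max.
by rewrite ler_piMl ?cos_max.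
Qed.

(** The unit vector of angle y is a combination of the unit vectors of angles 0 and h,
with coefficients sin (h - y) / sin h and sin y / sin h.  The bound on their sum says
that the chord between these two vectors stays at distance cos (h / 2) from 0. *)
Lemma chord_sum_le h y : 0 < h < pi -> 0 <= y <= h ->
  [/\ 0 <= sin (h - y), 0 <= sin y, 0 < sin h, 0 < cos (h / 2) &
    (sin (h - y) + sin y) / sin h <= (cos (h / 2))^-1].
Proof.
move=> /andP[h0 hpi] /andP[y0 yh].
have sh : 0 < sin h by rewrite sin_gt0_pi// h0.
have ch : 0 < cos (h / 2) by rewrite cos_gt0_pihalf//; apply/andP; split; lra.
have su : 0 < sin (h / 2) by rewrite sin_gt0_pi//; apply/andP; split; lra.
split => //.
- by rewrite sin_ge0_pi//; apply/andP; split; lra.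
- by rewrite sin_ge0_pi//; apply/andP; split; lra.
have hE : sin h = 2 * sin (h / 2) * cos (h / 2).
  by rewrite {1}(splitr h) sinD; ring.
have -> : sin (h - y) + sin y = 2 * sin (h / 2) * cos (h / 2 - y).
  rewrite {1}(_ : h - y = h / 2 + (h / 2 - y)); last by field.
  rewrite {2}(_ : y = h / 2 - (h / 2 - y)); last by ring.
  by rewrite sinD [sin (_ - (_ - _))]sinB; ring.
rewrite hE ler_pdivrMr ?mulr_gt0// [_^-1 * _]mulrC mulfK ?gt_eqF//.
by rewrite ler_piMr ?cos_le1// mulr_ge0// ltW.
Qed.

End Trigonometry.

Section Resonance.
Variables (R : realType) (a : R) (q : nat) (p : int) (h : R).
Hypothesis q0 : (0 < q)%N.
Hypothesis aqE : a *+ q = pi *+ 2 *~ p + h.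
Local Notation ball n := (set_expg (@generators R a) n).

(** The levels that are multiples of q provide the directions that are multiples of the
small angle h. *)
Lemma resonance_angle (j : int) : a *~ (j * q%:Z) = h *~ j + pi *+ 2 *~ (p * j).
Proof. by rewrite mulrC mulrzA mulrzA -pmulrn aqE mulrzDl addrC. Qed.

(** Lower bound for balls.  A vector of angle b lies between two consecutive multiples of
h, reached at two levels that are multiples of q and bounded independently of n; the
letters spent on reaching these levels make up the constant M. *)
Lemma disk_subset_ball : 0 < h < pi -> exists M : nat, forall n (k : int) z r,
  disk (cos (h / 2) * r) z -> r + (`|k| + M)%N%:R <= n%:R -> ball n (z, k).
Proof.
move=> hpi; have /andP[h0 _] := hpi.
pose J := (Num.trunc (pi / h)).+2.
(* J bounds the index of a multiple of h next to an angle in [-pi, pi]; the walk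
   through the levels j q and (j + 1) q then takes |j| q, q and at most
   |k| + (|j| + 1) q steps. *)
exists ((2 * J + 2) * q + 2)%N => n k z r zr hn.
have [rho [b [rho0 bpi zE]]] := polar_coordinates z.
pose j := Num.floor (b / h); pose y := b - h *~ j.
have /andP[jb bj] := floor_itv (b / h).
have hj : h *~ j = j%:~R * h by rewrite mulrC mulrzr.
have yh : 0 <= y <= h.
  move: jb bj; rewrite ler_pdivlMr// ltr_pdivrMr// intrD mulrDl mul1r /y hj -/j => h1 h2.
  by apply/andP; split; lra.
have jJ : (`|j| <= J)%N.
  rewrite -(ler_nat R) natr_absz intr_norm.
  have := truncnS_gt (pi / h); rewrite -/J /= => pJ.
  have [] : - (pi / h) <= b / h /\ b / h <= pi / h.
    by move/andP: bpi => [b1 b2]; rewrite -mulNr !ler_pM2r ?invr_gt0.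
  rewrite intrD in bj.
  have -> : J%:R = (Num.trunc (pi / h)).+1%:R + 1 :> R by rewrite natr1.
  by rewrite ler_norml -/j in jb bj *; lra.
have [sp s'p sh ch sum] := chord_sum_le hpi yh.
pose s := rho * (sin (h - y) / sin h); pose s' := rho * (sin y / sin h).
have rhor : rho <= cos (h / 2) * r.
  apply: le_trans (zr b); rewrite zE /proj/= -mulrA -expr2 -[_ * sin b * _]mulrA -expr2.
  by rewrite -mulrDr cos2Dsin2 mulr1.
have s0 : 0 <= s by rewrite mulr_ge0// divr_ge0// ltW.
have s'0 : 0 <= s' by rewrite mulr_ge0// divr_ge0// ltW.
have ss' : s + s' <= r.
  rewrite /s /s' -mulrDr -mulrDl.
  apply: (@le_trans _ _ (rho / cos (h / 2))); first by rewrite ler_wpM2l.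
  by rewrite ler_pdivrMr// mulrC.
have -> : z = rot (a *~ (j * q%:Z)) (s, 0) + rot (a *~ ((j + 1) * q%:Z)) (s', 0).
  rewrite !resonance_angle /rot/= !cos_periodic !sin_periodic !mulr0 subr0 !addr0 zE.
  have bE : b = h *~ j + y by rewrite /y addrC subrK.
  rewrite mulrzDr mulr1z subr0.
  have sN0 : sin h != 0 by rewrite gt_eqF.
  have sBE : s = rho * ((sin h * cos y - cos h * sin y) / sin h) by rewrite /s sinB.
  rewrite bE sBE /s'; clearbody y; move: (h *~ j) => t.
  by congr pair => /=; rewrite !(cosD, sinD); field.
apply: ball_two_directions; rewrite !ger0_norm//; apply: le_trans hn.
apply: lerD => //; rewrite ler_nat.
have -> : ((j + 1) * q%:Z - j * q%:Z)%R = q%:Z by rewrite mulrDl mul1r addrC addKr.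
rewrite abszM !absz_nat.
have h1 : (`|j| * q <= J * q)%N by rewrite leq_mul2r jJ orbT.
have h2 : (`|(k - (j + 1) * q%:Z)%R| <= `|k| + (`|j| + 1) * q)%N.
  apply: leq_trans (leqD_dist _ 0 _) _.
  rewrite subr0 leq_add2l sub0r abszN abszM absz_nat leq_mul2r.
  by apply/orP; right; clear; lia.
move: h1 h2; rewrite !mulnDl mul1n -mulnA; clear; lia.
Qed.

(** A lower bound for the depth of the gap between the unit circle and the regular
polygon with 2q vertices. *)
Definition cap : R := (8 * q%:R ^+ 2)^-1.

Lemma q_gt0 : 0 < q%:R :> R. Proof. by rewrite ltr0n. Qed.

Lemma cap_gt0 : 0 < cap.
Proof. by rewrite invr_gt0 mulr_gt0// exprn_gt0// q_gt0. Qed.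

Lemma cap_le1 : cap <= 1.
Proof.
rewrite invf_le1; last by rewrite mulr_gt0// exprn_gt0// q_gt0.
have : 1 <= q%:R :> R by rewrite ler1n.
by nra.
Qed.

(** The direction pi / 2q is halfway between two 2q-th roots of unity.  Multiplied by q,
the angle y between it and j a becomes h j - pi / 2 modulo 2 pi, whose sine is at
least 1 / 2 in absolute value; as |sin (q y)| <= q |sin y|, the angle y stays away from the
multiples of pi. *)
Lemma resonance_gap (j : int) : 1 / 2 <= `|cos (h *~ j)| ->
  `|cos (a *~ j - pi / 2 / q%:R)| <= 1 - cap.
Proof.
move=> hj; set y := _ - _.
have yq : y *+ q = h *~ j - pi / 2 + pi *+ 2 *~ (p * j).
  rewrite mulrnBl -[X in _ - X]mulr_natr divfK ?gt_eqF ?q_gt0//.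
  rewrite (_ : a *~ j *+ q = a *~ (j * q%:Z)); last by rewrite mulrzA pmulrn.
  by rewrite resonance_angle addrAC.
have : 1 / 2 <= q%:R * `|sin y|.
  apply: le_trans (normr_sin_mulrn_le y q).
  by rewrite yq sin_periodic sinBpihalf normrN.
have := cos2Dsin2 y; rewrite -real_normK ?num_real// -[sin y ^+ 2]real_normK ?num_real//.
move: (normr_ge0 (cos y)) (normr_ge0 (sin y)); move: `|cos y| `|sin y| => c s c0 s0 cs qs.
have := q_gt0; have := cap_le1; have := cap_gt0.
have qc : 8 * q%:R ^+ 2 * cap = 1 by rewrite mulfV// gt_eqF// mulr_gt0// exprn_gt0// q_gt0.
move=> cap0 cap1 qp.
have s2 : 2 * cap <= s ^+ 2.
  have : 1 / 4 <= (q%:R * s) ^+ 2 by nra.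
  rewrite exprMn => h1.
  have : 0 <= q%:R ^+ 2 * (s ^+ 2 - 2 * cap) by nra.
  by rewrite pmulr_rge0 ?exprn_gt0// subr_ge0.
rewrite -(@ler_pXn2r _ 2)// ?nnegrE ?subr_ge0//.
nra.
Qed.

End Resonance.

(** * Volume of balls *)

Lemma sum_cone_squares n :
  (3 * \sum_(0 <= i < n) ((n - i) ^ 2 + (n - i.+1) ^ 2) = 2 * n ^ 3 + n)%N.
Proof.
elim: n => [|n IH]; first by rewrite big_nil.
rewrite big_nat_recl// subn0 subSS subn0 mulnDr.
under eq_bigr do rewrite !subSS.
by rewrite IH; ring.
Qed.

(** The sum over all integers k of the squares of the positive parts of n - |k|. *)
Definition cone_volume (R : realType) (n : nat) : R := (2 * n%:R ^+ 3 + n%:R) / 3.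

Lemma esum_cone (R : realType) (C : R) n : 0 <= C ->
  (\esum_(k in [set: int]) (C * (n - `|k|)%:R ^+ 2)%:E)%E = (C * cone_volume R n)%:E.
Proof.
move=> C0; rewrite (@esum_int_finite _ _ n); first last.
- move=> k nk; have -> : (n - `|k| = 0)%N by apply/eqP; rewrite subn_eq0.
  by rewrite expr0n mulr0.
- by move=> k; rewrite lee_fin mulr_ge0// sqr_ge0.
under eq_bigr do rewrite -EFinD -mulrDr.
rewrite sumEFin -mulr_sumr; congr (_ * _)%:E.
apply: (@mulfI _ 3%:R); first by rewrite pnatr_eq0.
rewrite /cone_volume mulrC [RHS]mulrC divfK ?pnatr_eq0// mulrC.
have -> : 2 * n%:R ^+ 3 + n%:R = (2 * n ^ 3 + n)%:R :> R.
  by rewrite natrD natrM natrX.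
rewrite -sum_cone_squares natrM natr_sum; congr (_ * _); apply: eq_bigr => i _.
by rewrite natrD !natrX.
Qed.

Section Volume.
Variables (R : realType) (a : R).
Local Notation G := (motion a).
Local Notation ball n := (set_expg (@generators R a) n).
Local Notation A := (disk_area R).

Lemma measurable_ball n : measurable (ball n : set (borel G)).
Proof.
apply: measurable_closed; apply: compact_closed; first exact: motion_hausdorff.
by apply: compact_set_expg; exact: compact_generators.
Qed.

Lemma measure_fiber_ball_le n k C : 0 <= C ->
  ((`|k| <= n)%N -> (plane_measure (fiber (ball n) k) <= (C * (n - `|k|)%:R ^+ 2 * A)%:E)%E) ->
  (plane_measure (fiber (ball n) k) <= (C * A * (n - `|k|)%:R ^+ 2)%:E)%E.
Proof.
move=> C0; rewrite mulrAC; have [kn /(_ isT)//|kn _] := leqP `|k| n.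
rewrite (_ : fiber _ _ = set0).
  by rewrite measure0 lee_fin !mulr_ge0// ?sqr_ge0// ltW// disk_area_gt0.
by apply/seteqP; split => // z /ball_disk[]; rewrite leqNgt kn.
Qed.

Lemma haar_ball_le n : (haar (ball n : set (borel G)) <= (A * cone_volume R n)%:E)%E.
Proof.
have A0 := ltW (disk_area_gt0 R).
rewrite -esum_cone//; apply: le_esum => k _.
rewrite -[A]mul1r; apply: measure_fiber_ball_le => // kn.
rewrite mul1r -measure_disk//; apply: le_measure; rewrite ?inE.
- by apply: measurable_fiber; exact: measurable_ball.
- exact: measurable_disk.
- by move=> z /ball_disk[_]; rewrite natrB.
Qed.

Lemma haar_ball_capped_le n b w : 0 < w <= 1 ->
  (forall j : int, (`|j| <= n)%N -> `|cos (a *~ j - b)| <= 1 - w) ->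
  (haar (ball n : set (borel G)) <= ((1 - w ^+ 2 / 9) * A * cone_volume R n)%:E)%E.
Proof.
move=> w01 hw; have /andP[w0 w1] := w01.
have A0 := ltW (disk_area_gt0 R).
have C0 : 0 <= 1 - w ^+ 2 / 9 by nra.
rewrite -esum_cone ?mulr_ge0//; apply: le_esum => k _.
apply: measure_fiber_ball_le => // kn.
apply: (@measure_capped_disk _ _ b) => //.
- by apply: measurable_fiber; exact: measurable_ball.
- by move=> z /ball_disk[_]; rewrite natrB.
- move=> z /(ball_proj_le (b := b) (c := 1 - w))[||_]; rewrite ?subr_ge0// natrB//.
Qed.

(** Truncated subtraction covers the case n < M as well: the cone is then empty. *)
Lemma haar_ball_ge (c : R) (M : nat) : 0 <= c ->
  (forall n (k : int) z r, disk (c * r) z -> r + (`|k| + M)%N%:R <= n%:R -> ball n (z, k)) ->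
  forall n, ((c ^+ 2 * A * cone_volume R (n - M)%N)%:E <= haar (ball n : set (borel G)))%E.
Proof.
move=> c0 hM n; have A0 := ltW (disk_area_gt0 R).
rewrite -esum_cone ?mulr_ge0 ?sqr_ge0//; apply: le_esum => k _.
have [kn|kn] := ltnP `|k| (n - M); last first.
  by rewrite (eqP (_ : (n - M - `|k| == 0)%N)) ?expr0n ?mulr0// subn_eq0.
rewrite mulrAC -exprMn -measure_disk ?mulr_ge0//; apply: le_measure; rewrite ?inE.
- exact: measurable_disk.
- by apply: measurable_fiber; exact: measurable_ball.
- move=> z zD; apply: (hM _ _ _ _ zD).
  by rewrite -natrD ler_nat; move: kn; clear; lia.
Qed.

End Volume.

(** * Choice of the angle and asymptotics *)

Section Angle.
Variables (R : realType) (eps : nat -> R).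
Hypothesis eps_cvg0 : eps n @[n --> \oo] --> 0.

(** N is a precision.  The last clause is the deficiency at scale n: the cap missed by the
directions of the levels up to n costs more volume than eps n, even after the lower
order factor 1 + 1 / 2n^2 of the volume of the cone.  The bound on cos (h / 2) ensures
that the fibres of large balls almost fill the disks that contain them. *)
Definition nearly_rational (N : nat) (a : R) : Prop :=
  exists q p h, [/\ (0 < q)%N, a *+ q = pi *+ 2 *~ p + h, 0 < h < pi,
    1 - N.+1%:R^-1 <= cos (h / 2) &
    exists n, [/\ (N <= n)%N, (0 < n)%N,
      forall j : int, (`|j| <= n)%N -> 1 / 2 <= `|cos (h *~ j)| &
      (1 - cap R q ^+ 2 / 9) * (1 + (2 * n%:R ^+ 2)^-1) <= 1 - eps n]].

Lemma cos_near1 (e : R) : 0 < e -> exists2 d : R, 0 < d & forall x, `|x| < d -> 1 - e <= cos x.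
Proof.
move=> e0; have := @continuous_cos R 0; rewrite /continuous_at cos0.
move=> /cvgrPdist_le /(_ e e0) /nbhs_ballP[d d0 hd]; exists d => // x xd.
have := hd x; rewrite /ball/= sub0r normrN => /(_ xd).
by rewrite ler_norml => /andP[_]; lra.
Qed.

(** The left-hand side tends to a limit less than 1 and eps tends to 0; here q is fixed,
and the scale is chosen before the angle. *)
Lemma exists_deficient_scale (q N : nat) : (0 < q)%N -> exists n, [/\ (N <= n)%N, (0 < n)%N &
  (1 - cap R q ^+ 2 / 9) * (1 + (2 * n%:R ^+ 2)^-1) <= 1 - eps n].
Proof.
move=> q0; set d := cap R q ^+ 2 / 18.
have w0 := cap_gt0 R q0; have w1 := cap_le1 R q0.
have d0 : 0 < d by rewrite divr_gt0// exprn_gt0.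
have /cvgr0Pnorm_le /(_ d d0)[K _ hK] := eps_cvg0.
pose n := maxn (maxn N K) (Num.bound d^-1).+1.
have n0 : (0 < n)%N by rewrite /n; lia.
exists n; split => //; first by rewrite /n; lia.
have epsn : eps n <= d.
  by apply: le_trans (ler_norm _) (hK n _); rewrite /= /n; lia.
have nd : d^-1 <= n%:R.
  apply: ltW; apply: lt_le_trans (archi_boundP _) _; first by rewrite invr_ge0 ltW.
  by rewrite ler_nat /n; lia.
have nd' : (2 * n%:R ^+ 2)^-1 <= d.
  have n1 : 1 <= n%:R :> R by rewrite ler1n.
  rewrite -[d]invrK lef_pV2 ?posrE ?mulr_gt0 ?exprn_gt0 ?invr_gt0 ?ltr0n//.
  by apply: le_trans nd _; nra.
have i0 : 0 <= (2 * n%:R ^+ 2)^-1 :> R by rewrite invr_ge0 mulr_ge0// sqr_ge0.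
rewrite (_ : cap R q ^+ 2 / 9 = 2 * d); last by rewrite /d; field.
by nra.
Qed.

Lemma exists_resonance_width (n N : nat) : exists2 d : R, 0 < d &
  forall h, 0 < h < d -> [/\ 0 < h < pi, 1 - N.+1%:R^-1 <= cos (h / 2) &
    forall j : int, (`|j| <= n)%N -> 1 / 2 <= `|cos (h *~ j)|].
Proof.
have [d1 d10 h1] : exists2 d : R, 0 < d & forall x, `|x| < d -> 1 - N.+1%:R^-1 <= cos x.
  by apply: cos_near1; rewrite invr_gt0.
have [d2 d20 h2] : exists2 d : R, 0 < d & forall x, `|x| < d -> 1 - 1 / 2 <= cos x.
  by apply: cos_near1; lra.
have pi0 := pi_gt0 R.
exists (Num.min pi (Num.min d1 (d2 / n.+1%:R))).
  by rewrite !lt_min pi0 d10 divr_gt0.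
move=> h /andP[h0]; rewrite !lt_min => /and3P[hpi hd1 hd2]; split.
- by rewrite h0.
- by apply: h1; rewrite ger0_norm; lra.
- move=> j jn; apply: le_trans (ler_norm _).
  apply: (@le_trans _ _ (1 - 1 / 2)); first by lra.
  apply: h2; rewrite -mulrzr normrM (gtr0_norm h0) -intr_norm -natr_absz.
  move: hd2; rewrite ltr_pdivlMr ?ltr0n//; apply: le_lt_trans.
  by rewrite ler_wpM2l ?(ltW h0)// ler_nat leqW.
Qed.

(** Multiples of 2 pi / q with q large are dense, and an interval to the right of each of
them consists of angles with the required property. *)
Lemma dense_nearly_rational N : dense (nearly_rational N)°.
Proof.
move=> O [a0 Oa0] oO.
have [e /= e0 eO] := (nbhs_ballP _ _).1 (open_nbhs_nbhs (conj oO Oa0)).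
have pi0 := pi_gt0 R.
pose q := (Num.bound ((pi *+ 2 + 1) / e)).+1.
have q0 : (0 < q)%N by [].
have qR0 : 0 < q%:R :> R by rewrite ltr0n.
have qe : pi *+ 2 + 1 < e * q%:R.
  rewrite mulrC -ltr_pdivrMr//; apply: lt_le_trans (archi_boundP _) _.
    by rewrite divr_ge0 ?(ltW e0)// addr_ge0// mulrn_wge0// ltW.
  by rewrite ler_nat.
have [n [Nn n0 nE]] := exists_deficient_scale N q0.
have [d d0 hd] := exists_resonance_width n N.
pose p := Num.floor (a0 * q%:R / (pi *+ 2)).
pose h0 := Num.min (d / 2) 1.
have h00 : 0 < h0 by rewrite lt_min ltr01 andbT; lra.
have h01 : h0 <= 1 by rewrite ge_min lexx orbT.
have h0d : h0 < d.
  by apply: (@le_lt_trans _ _ (d / 2)); [rewrite ge_min lexx|lra].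
have pi20 : 0 < pi *+ 2 :> R by rewrite mulrn_wgt0.
have /andP[] := floor_itv (a0 * q%:R / (pi *+ 2)); rewrite -/p.
rewrite ler_pdivlMr// ltr_pdivrMr// intrD mulrDl mul1r => p1 p2.
pose base := p%:~R * (pi *+ 2) : R.
pose a := (base + h0) / q%:R.
have aq : a * q%:R = base + h0 by rewrite /a divfK// gt_eqF.
exists a; split.
  apply: eO; rewrite /ball/= -(ltr_pM2r qR0) -{1}(gtr0_norm qR0) -normrM mulrBl aq.
  by rewrite ltr_norml /base; apply/andP; split; lra.
have ainI : a \in `]base / q%:R, (base + d) / q%:R[.
  by rewrite in_itv/= /a !ltr_pM2r ?invr_gt0//; apply/andP; split; lra.
apply: filterS (near_in_itvoo ainI) => a'.
rewrite /= in_itv/= ltr_pdivrMr// ltr_pdivlMr// => /andP[a'1 a'2].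
have [] := hd (a' * q%:R - base); first by apply/andP; split; lra.
move=> h1 h2 h3; exists q, p, (a' * q%:R - base); split => //.
  by rewrite -[a' *+ q]mulr_natr /base [p%:~R * _]mulrzl addrC subrK.
by exists n; split.
Qed.

Lemma exists_nearly_rational : exists a, forall N, nearly_rational N a.
Proof.
have [] := @Baire R R (fun N => (nearly_rational N)°) _ setT.
- by move=> N; split; [exact: open_interior|exact: dense_nearly_rational].
- by exists 0.
- exact: openT.
by move=> a [_ ha]; exists a => N; apply: interior_subset; exact: ha.
Qed.

End Angle.

Section Growth.
Variables (R : realType) (eps : nat -> R) (a : R).
Hypothesis a_good : forall N, nearly_rational eps N a.
Local Notation G := (motion a).
Local Notation ball n := (set_expg (@generators R a) n).
Local Notation A := (disk_area R).

Definition volume (n : nat) : R := fine (haar (ball n : set (borel G))).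

Lemma volumeE n : haar (ball n : set (borel G)) = (volume n)%:E.
Proof.
rewrite fineK// ge0_fin_numE//.
by apply: le_lt_trans (haar_ball_le a n) _; rewrite ltry.
Qed.

Definition growth_constant : R := 2 / 3 * A.

Lemma growth_constant_gt0 : 0 < growth_constant.
Proof. by rewrite mulr_gt0 ?disk_area_gt0// divr_gt0. Qed.

Lemma cone_volumeE n : (0 < n)%N ->
  A * cone_volume R n = growth_constant * n%:R ^+ 3 * (1 + (2 * n%:R ^+ 2)^-1).
Proof.
move=> n0; have nN0 : n%:R != 0 :> R by rewrite pnatr_eq0 -lt0n.
by rewrite /cone_volume /growth_constant; field.
Qed.

Lemma ratio_le n : (0 < n)%N ->
  volume n / (growth_constant * n%:R ^+ 3) <= 1 + (2 * n%:R ^+ 2)^-1.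
Proof.
move=> n0; rewrite ler_pdivrMr; last first.
  by rewrite mulr_gt0 ?growth_constant_gt0// exprn_gt0// ltr0n.
by rewrite mulrC -cone_volumeE// -lee_fin -volumeE haar_ball_le.
Qed.

Lemma ratio_deficient N : exists2 n, (N <= n)%N /\ (0 < n)%N &
  volume n / (growth_constant * n%:R ^+ 3) <= 1 - eps n.
Proof.
have [q [p [h [q0 aq hpi _ [n [Nn n0 hn nE]]]]]] := a_good N.
exists n => //; apply: le_trans nE.
rewrite ler_pdivrMr; last by rewrite mulr_gt0 ?growth_constant_gt0// exprn_gt0// ltr0n.
rewrite -mulrA [X in _ * X]mulrC -cone_volumeE// mulrA -lee_fin -volumeE.
apply: (@haar_ball_capped_le _ _ _ (pi / 2 / q%:R)).
  by rewrite cap_gt0// cap_le1.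
by move=> j jn; apply: (resonance_gap q0 aq); exact: hn.
Qed.

Lemma ratio_ge N : exists M : nat, forall n, (M <= n)%N -> (0 < n)%N ->
  (1 - N.+1%:R^-1) ^+ 2 * (1 - M%:R / n%:R) ^+ 3 <= volume n / (growth_constant * n%:R ^+ 3).
Proof.
have [q [p [h [q0 aq hpi hN _]]]] := a_good N.
have [M hM] := disk_subset_ball aq hpi.
exists M => n Mn n0.
have nR0 : 0 < n%:R :> R by rewrite ltr0n.
have N1 : 0 <= 1 - N.+1%:R^-1 :> R by rewrite subr_ge0 invf_le1 ?ler1n ?ltr0n.
have ch0 : 0 <= cos (h / 2) by exact: le_trans N1 hN.
have := haar_ball_ge ch0 hM n.
rewrite volumeE lee_fin => vn.
rewrite ler_pdivlMr; last by rewrite mulr_gt0 ?growth_constant_gt0// exprn_gt0.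
apply: le_trans vn.
have -> : (1 - N.+1%:R^-1) ^+ 2 * (1 - M%:R / n%:R) ^+ 3 * (growth_constant * n%:R ^+ 3) =
    (1 - N.+1%:R^-1) ^+ 2 * A * (2 / 3 * (n - M)%N%:R ^+ 3).
  rewrite natrB// /growth_constant; by field; rewrite nat1r !pnatr_eq0 -!lt0n n0.
have A0 := disk_area_gt0 R.
apply: ler_pM.
- by rewrite mulr_ge0 ?sqr_ge0// ltW.
- by rewrite mulr_ge0// exprn_ge0.
- by rewrite ler_pM2r// ler_pXn2r ?nnegrE.
- rewrite /cone_volume mulrAC ler_pM2r ?invr_gt0//.
  by rewrite lerDl.
Qed.

Lemma ratio_cvg1 : volume n / (growth_constant * n%:R ^+ 3) @[n --> \oo] --> (1 : R).
Proof.
apply/cvgrPdist_le => e e0.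
pose e' := Num.min e 1.
have e'0 : 0 < e' by rewrite lt_min e0 ltr01.
have e'e : e' <= e by rewrite ge_min lexx.
have e'1 : e' <= 1 by rewrite ge_min lexx orbT.
pose N := Num.bound (4 / e').
have N4 : N.+1%:R^-1 <= e' / 4.
  rewrite -[e' / 4]invrK invf_div lef_pV2 ?posrE ?ltr0n ?divr_gt0//.
  apply: ltW; apply: lt_le_trans (archi_boundP _) _; first by rewrite divr_ge0// ltW.
  by rewrite ler_nat.
have [M hM] := ratio_ge N.
pose K := (Num.bound (6 * M%:R / e')).+1.
near=> n.
have n0 : (0 < n)%N by near: n; exact: nbhs_infty_ge.
have Mn : (M <= n)%N by near: n; exact: nbhs_infty_ge.
have Kn : (K <= n)%N by near: n; exact: nbhs_infty_ge.
have Nn : (N.+1 <= n)%N by near: n; exact: nbhs_infty_ge.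
have nR0 : 0 < n%:R :> R by rewrite ltr0n.
have n1 : 1 <= n%:R :> R by rewrite ler1n.
have Nn' : n%:R^-1 <= e' / 4.
  by apply: le_trans N4; rewrite lef_pV2 ?posrE ?ltr0n// ler_nat.
have up : (2 * n%:R ^+ 2)^-1 <= n%:R^-1 :> R.
  by rewrite lef_pV2 ?posrE ?mulr_gt0 ?exprn_gt0//; nra.
have Mn6 : M%:R / n%:R <= e' / 6.
  have : 6 * M%:R / e' <= n%:R.
    apply: ltW; apply: lt_le_trans (archi_boundP _) _.
      by rewrite divr_ge0 ?mulr_ge0// ltW.
    by rewrite ler_nat; apply: leq_trans Kn.
  by rewrite !ler_pdivrMr//; lra.
have lo := hM n Mn n0.
have hi := ratio_le n0.
have M0 : 0 <= M%:R / n%:R :> R by rewrite divr_ge0.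
have N0 : 0 <= N.+1%:R^-1 :> R by rewrite invr_ge0.
set x := M%:R / n%:R in Mn6 lo M0 *; set y := N.+1%:R^-1 in N4 lo N0 *.
have x3 : 1 - 3 * x <= (1 - x) ^+ 3 by nra.
have y2 : 1 - 2 * y <= (1 - y) ^+ 2 by nra.
have xy : 1 - 3 * x - 2 * y <= (1 - y) ^+ 2 * (1 - x) ^+ 3.
  apply: (@le_trans _ _ ((1 - 2 * y) * (1 - 3 * x))); first by nra.
  by apply: ler_pM => //; lra.
by rewrite ler_norml; apply/andP; split; lra.
Unshelve. all: by end_near.
Qed.

(** Balls contain disks of arbitrarily large radius at every level. *)
Lemma generators_generate : generating_set (@generators R a).
Proof.
apply/seteqP; split => // -[z k] _ H [Hsub Hgen].
have [q [p [h [q0 aq hpi _ _]]]] := a_good 0.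
have [M hM] := disk_subset_ball aq hpi.
have /andP[h0 hpi'] := hpi.
have ch0 : 0 < cos (h / 2) by rewrite cos_gt0_pihalf//; apply/andP; split; lra.
pose r := (`|z.1| + `|z.2|) / cos (h / 2).
have r0 : 0 <= r by rewrite divr_ge0 ?addr_ge0// ltW.
apply: (set_expg_subgroup Hsub Hgen (n := ((Num.bound r) + (`|k : int| + M))%N)).
apply: (hM _ _ _ r).
  move=> b; rewrite /r mulrC divfK ?gt_eqF// /proj; apply: lerD.
    by apply: le_trans (ler_norm _) _; rewrite normrM ler_piMr// cos_max.
  by apply: le_trans (ler_norm _) _; rewrite normrM ler_piMr// sin_max.
by rewrite [in leRHS]natrD lerD2r ltW// archi_boundP.
Qed.

End Growth.

Theorem theorem8p1 (R : realType) (eps : nat -> R)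
    (eps_gt0 : forall n, 0 < eps n) (eps_cvg0 : eps n @[n --> \oo] --> 0) :
  exists (G : topologicalGroupType) (vol : {measure set (borel G) -> \bar R})
         (Omega : set G) (c : R),
    [/\ locally_compact_group G,
        is_haar_measure vol &
        polynomial_growth_of_degree vol 3] /\
    [/\ compact Omega, generating_set Omega & 0 < c] /\
    (forall N : nat, exists2 n : nat, (N <= n)%N &
       (vol (set_expg Omega n) / (c * n%:R ^+ 3)%:E <= (1 - eps n)%:E)%E) /\
    (vol (set_expg Omega n) / (c * n%:R ^+ 3)%:E)%E @[n --> \oo] --> 1%E.
Proof.
have [a a_good] := exists_nearly_rational eps_cvg0.
have c0 := growth_constant_gt0 R.
have cvg1 := ratio_cvg1 a_good.
exists (motion a), (@haar R a), (@generators R a), (growth_constant R).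
have ratioE n : (0 < n)%N ->
    (haar (set_expg (@generators R a) n : set (borel (motion a))) /
      (growth_constant R * n%:R ^+ 3)%:E =
    (volume a n / (growth_constant R * n%:R ^+ 3))%:E)%E.
  by move=> n0; rewrite volumeE inver gt_eqF// mulr_gt0// exprn_gt0// ltr0n.
split; last split; last split.
- split; [exact: motion_locally_compact|exact: haar_is_haar_measure|].
  exists (@generators R a); split.
  + exact: compact_generators.
  + exact: symmetric_generators.
  + exact: generators_generate a_good.
  + exists (growth_constant R / 2), (growth_constant R * 2); split.
    * by rewrite divr_gt0.
    * by rewrite mulr_gt0.
    have /cvgrPdist_le/(_ (1 / 2)) := cvg1; rewrite divr_gt0// => /(_ isT) near1.
    near=> n.
    have n0 : (0 < n)%N by near: n; exact: nbhs_infty_ge.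
    have cn0 : 0 < growth_constant R * n%:R ^+ 3 by rewrite mulr_gt0// exprn_gt0// ltr0n.
    rewrite [X in (_ <= X <= _)%E](volumeE a n) !lee_fin.
    have : `|1 - volume a n / (growth_constant R * n%:R ^+ 3)| <= 1 / 2 by near: n.
    rewrite ler_norml => /andP[h1 h2].
    have h3 : volume a n / (growth_constant R * n%:R ^+ 3) <= 3 / 2 by lra.
    have h4 : 1 / 2 <= volume a n / (growth_constant R * n%:R ^+ 3) by lra.
    by rewrite ler_pdivrMr// in h3; rewrite ler_pdivlMr// in h4; apply/andP; split; lra.
- by split; [exact: compact_generators|exact: generators_generate a_good|].
- move=> N; have [n [Nn n0] nE] := ratio_deficient a_good N.
  by exists n => //; rewrite ratioE// lee_fin.
- have : (volume a n / (growth_constant R * n%:R ^+ 3))%:E @[n --> \oo] --> (1 : R)%:E.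
    by apply: cvg_comp cvg1 _; exact: cvg_id.
  apply: cvg_trans; apply: near_eq_cvg; near=> n; rewrite ratioE//.
  by near: n; exact: nbhs_infty_ge.
Unshelve. all: by end_near.
Qed.
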